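(* For each $n$, let $S_n=\sum_{v\in V_n}A_{v,n}$ be a finite sum of real random variables with $|A_{v,n}|\le A$ almost surely for all $v\in V_n$, where $A>0$ does not depend on $n$, and $\mathrm{Var}(S_n)>0$. Assume that the family $(A_{v,n})_{v\in V_n}$ has a dependency graph of maximal degree $D_n-1$, and set $$N_n=\frac{\sum_{v\in V_n}\mathbb E|A_{v,n}|}{A},\qquad(\widetilde\sigma_n)^2=\frac{\mathrm{Var}(S_n)}{N_nD_n},\quad\widetilde\sigma_n>0.$$ Then for all $n$ $$d_{\mathrm{Kol}}\left(\frac{S_n-\mathbb E[S_n]}{\sqrt{\mathrm{Var}(S_n)}}\,,\,\mathcal N_{\mathbb R}(0,1)\right)\le\frac{52.52\,A^3}{(\widetilde\sigma_n)^3}\sqrt{\frac{D_n}{N_n}}.$$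
   Context: $d_{\mathrm{Kol}}(X,Y)=\sup_{a\in\mathbb R}|\mathbb P[X\le a]-\mathbb P[Y\le a]|$ is the Kolmogorov distance; $\mathcal N_{\mathbb R}(0,1)$ is the standard Gaussian law. A (simple) graph $G=(V,E)$ is a dependency graph for a family $(A_v)_{v\in V}$ of real random variables if, whenever $V_1,V_2\subset V$ are disjoint and no edge of $E$ joins a vertex of $V_1$ to a vertex of $V_2$, the random vectors $(A_v)_{v\in V_1}$ and $(A_v)_{v\in V_2}$ are independent. *)

(* Defs.v *)
From HB Require Import structures.
From mathcomp Require Export all_boot all_order all_algebra.
From mathcomp Require Export all_classical all_reals all_analysis.
From mathcomp Require Export measurable_realfun.

Set Implicit Arguments.
Unset Strict Implicit.
Unset Printing Implicit Defensive.

Import Order.TTheory GRing.Theory Num.Theory.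
Import numFieldNormedType.Exports.

Local Open Scope classical_set_scope.
Local Open Scope ring_scope.

Record simple_graph (V : finType) := SimpleGraph {
  edge :> rel V;
  edge_sym : symmetric edge;
  edge_irr : irreflexive edge }.

Definition degree (V : finType) (G : simple_graph V) (v : V) : nat :=
  #|[pred w | G v w]|.

Definition max_degree (V : finType) (G : simple_graph V) : nat :=
  (\max_(v : V) degree G v)%N.

Section random_vectors.
Context d (T : measurableType d) (R : realType) (P : probability T R).

Definition independent_rv d1 d2
    (T1 : measurableType d1) (T2 : measurableType d2)
    (X : T -> T1) (Y : T -> T2) : Prop :=
  forall (B : set T1) (C : set T2), measurable B -> measurable C ->
    P (X @^-1` B `&` Y @^-1` C) = (P (X @^-1` B) * P (Y @^-1` C))%E.

(* The random vector (A_v)_(v in W), with its coordinates listed in the order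
   of enum W and R ^ #|W| carrying the product sigma-algebra. *)
Definition random_vector (V : finType) (A : V -> {RV P >-> R}) (W : {set V})
    (w : T) : #|W|.-tuple R :=
  [tuple A (enum_val i) w | i < #|W|].

Lemma measurable_random_vector (V : finType) (A : V -> {RV P >-> R})
    (W : {set V}) : measurable_fun setT (random_vector A W).
Proof.
apply/measurable_fun_tnthP => i; apply: (eq_measurable_fun (A (enum_val i))) => //.
by move=> w _; rewrite /= tnth_mktuple.
Qed.

Definition dependency_graph (V : finType) (A : V -> {RV P >-> R})
    (G : simple_graph V) : Prop :=
  forall V1 V2 : {set V}, [disjoint V1 & V2]%B ->
    (forall v1 v2, v1 \in V1 -> v2 \in V2 -> ~~ G v1 v2) ->
    independent_rv (random_vector A V1) (random_vector A V2).

Definition standardize (X : {RV P >-> R}) : T -> R :=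
  fun w => (X w - fine 'E_P[X]) / Num.sqrt (fine 'V_P[X]).

Lemma measurable_standardize (X : {RV P >-> R}) :
  measurable_fun setT (standardize X).
Proof. by apply: measurable_funM => //; exact: measurable_funB. Qed.

HB.instance Definition _ (X : {RV P >-> R}) :=
  isMeasurableFun.Build _ _ _ _ (standardize X) (measurable_standardize X).

End random_vectors.

(* Only the laws enter the Kolmogorov distance, so it takes the laws themselves.
   They are typed as plain set functions because distribution P X is a
   probability on R whereas normal_prob is one on measurableTypeR R, which has
   the same measurable sets but a different display. *)
Definition dKol (R : realType) (mu nu : set R -> \bar R) : R :=
  sup [set `|fine (mu `]-oo, a]%classic) - fine (nu `]-oo, a]%classic)|
      | a in [set: R]].

(* Main.v *)
From HB Require Import structures.
Require Import Defs.
From mathcomp Require Import ring lra.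

Set Implicit Arguments.
Unset Strict Implicit.
Unset Printing Implicit Defensive.

Import Order.TTheory GRing.Theory Num.Theory.
Import numFieldNormedType.Exports.

Local Open Scope classical_set_scope.
Local Open Scope ring_scope.

(** Stein's method.  Write [W] for the standardized sum, [X_v] for its
    summands, [D] for one plus the maximal degree, [s ^ 2 = Var S] and
    [eps = N D^2 A^3 / s^3], so that the bound to prove is [52.52 eps].  For a
    piecewise linear approximation [h], of width [lam], of the indicator of a
    half-line, the solution [f] of [f' - x f = h - E h(Z)] satisfies
    [0 <= f <= 2] and [|f'| <= 1].  Since [X_v] is independent of
    [W_v = W - Y_v], where [Y_v] sums the [X_u] over the closed neighbourhood
    of [v], a Taylor expansion of [f] at [W] bounds
    [E h(W) - E h(Z) = E (f'(W) - W f(W))] by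
    - [E |1 - Q|] with [Q = \sum_v X_v Y_v], of mean 1, controlled by counting
      the pairs of edges that are not independent;
    - a remainder of order [eps (1 + P(W in window) / lam)], where the window
      has length about [lam], so that its probability is at most
      [lam + 2 dKol] up to constants.
    Taking [lam = 32 eps] gives [dKol <= 36 eps + dKol / 4], roughly.
    [Var S <= N D A^2] makes every other error term a multiple of [eps]. *)

(** * The standard normal distribution function *)

Section gaussian.
Context {R : realType}.
Notation mu := (@lebesgue_measure R).
Local Notation phi := (@normal_pdf R 0 1).

Definition normal_cdf (x : R) : R := fine (normal_prob 0 1 `]-oo, x]).

Lemma std_normal_pdfE x : phi x = normal_peak 1 * expR (- (x ^+ 2 / 2)).
Proof.
by rewrite normal_pdfE ?oner_eq0// /normal_fun subr0 expr1n mulNr.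
Qed.

Lemma std_normal_pdf_gt0 x : 0 < phi x.
Proof. by rewrite std_normal_pdfE mulr_gt0 ?expR_gt0// normal_peak_gt0// oner_eq0. Qed.

Lemma is_derive_std_normal_pdf x : is_derive x (1:R) phi (- x * phi x).
Proof.
have -> : phi = (fun y => normal_peak 1 * expR (- (y ^+ 2 / 2))).
  by apply/funext => y; exact: std_normal_pdfE.
have H : is_derive x (1 : R) (fun y : R => expR (- (y ^+ 2 / 2)))
   (- x * expR (- (x ^+ 2 / 2))).
  have H1 : is_derive x (1:R) (fun y : R => - (y ^+ 2 / 2)) (- x).
    apply: is_derive_eq. rewrite /GRing.scale /=. lra.
  have := @is_derive1_comp _ expR (fun y : R => - (y ^+ 2 / 2)) x _ _ _ H1.
  move=> H2. apply: is_derive_eq. 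
  exact: mulrC.
apply: is_derive_eq.
rewrite /GRing.scale /= mulrCA //.
Qed.

(** The peak [1 / sqrt (2 pi)] is at most [1/2] because [pi >= 2]. This makes [normal_cdf] Lipschitz
    with constant [1/2], the only quantitative fact about the Gaussian law used later. *)
Lemma std_normal_pdf_le x : phi x <= 2^-1.
Proof.
apply: le_trans (normal_pdf_ub _ _ (oner_neq0 _)) _.
rewrite /normal_peak lef_pV2 ?posrE//; last first.
  by rewrite sqrtr_gt0 expr1n mul1r mulrn_wgt0// pi_gt0.
rewrite expr1n mul1r.
have -> : (2 : R) = Num.sqrt (2 ^+ 2) by rewrite sqrtr_sqr ger0_norm.
have := @pi_ge2 R => pi2; rewrite ler_sqrt; first lra.
by rewrite mulr2n addr_ge0 ?pi_ge0.
Qed.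

Lemma integrable_std_normal_pdf (A : set R) : measurable A ->
  mu.-integrable A (EFin \o phi).
Proof. move=> mA; apply: integrableS (integrable_normal_pdf 0 1) => //. Qed.

Lemma normal_cdfE x : normal_cdf x = \int[mu]_(t in `]-oo, x]) phi t.
Proof. by []. Qed.

Lemma normal_cdf_ge0 x : 0 <= normal_cdf x.
Proof. exact: fine_ge0. Qed.

Lemma normal_cdfC x : \int[mu]_(t in `]x, +oo[) phi t = 1 - normal_cdf x.
Proof.
have := @Rintegral_itvB R phi -oo%O +oo%O x.
rewrite -normal_cdfE => <- //; last first.
  by apply: integrable_std_normal_pdf.
by rewrite set_itvNyy /Rintegral integral_normal_pdf.
Qed.

Lemma normal_cdf_le1 x : normal_cdf x <= 1.
Proof.
rewrite -subr_ge0 -normal_cdfC; apply: Rintegral_ge0 => y _; exact: normal_pdf_ge0.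
Qed.

Lemma normal_cdfB a b : a <= b -> 0 <= normal_cdf b - normal_cdf a <= (b - a) / 2.
Proof.
move=> ab; rewrite !normal_cdfE Rintegral_itvB//; last exact: integrable_std_normal_pdf.
apply/andP; split; first by apply: Rintegral_ge0 => y _; exact: normal_pdf_ge0.
apply: (@le_trans _ _ (\int[mu]_(t in `]a, b]) 2^-1)).
  apply: le_Rintegral => //; first exact: integrable_std_normal_pdf.
    apply/integrableP; split; first exact: measurable_cst.
    by rewrite integral_cst//= lebesgue_measure_itv/=; case: ifP => _;
     rewrite -EFinM ltry.
  by move=> x _; exact: std_normal_pdf_le.
rewrite Rintegral_cst//= lebesgue_measure_itv/= lte_fin.
by case: ltP => /=; lra.
Qed.
End gaussian.

(** * Limits of the normal distribution function at infinity *)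

Section tails.
Context {R : realType}.
(** The identity, viewed as a random variable under [normal_prob 0 1], has [normal_cdf] as its
    distribution function, so the general limits of distribution functions apply. *)
Let idR : measurableTypeR R -> R := idfun.
#[local] HB.instance Definition _ :=
  @isMeasurableFun.Build _ _ _ _ idR (@measurable_id _ _ setT).

Lemma cvg_normal_cdf_Ny0 : @normal_cdf R x @[x --> -oo] --> (0:R).
Proof.
have := @cvg_cdfNy0 _ _ _ (normal_prob 0 1) (idR : {RV (normal_prob (0:R) 1) >-> R}).
by move=> /fine_cvg; exact.
Qed.

Lemma cvg_normal_cdf_y1 : @normal_cdf R x @[x --> +oo] --> (1:R).
Proof.
have := @cvg_cdfy1 _ _ _ (normal_prob 0 1) (idR : {RV (normal_prob (0:R) 1) >-> R}).
by move=> /fine_cvg; exact.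
Qed.

Lemma normal_cdf_small (x e : R) : 0 < e -> exists2 y, y <= x & normal_cdf y < e.
Proof.
move=> e0.
have H1 : \forall y \near -oo, normal_cdf y < e.
  exact: (cvgr_lt _ cvg_normal_cdf_Ny0).
have H2 : \forall y \near -oo, y <= x by apply: nbhs_ninfty_le; exact: num_real.
near (-oo : set_system R) => y.
by exists y; [near: y; exact: H2|near: y; exact: H1].
Unshelve. all: by end_near. Qed.

Lemma normal_cdfC_small (x e : R) : 0 < e -> exists2 y, x <= y & 1 - normal_cdf y < e.
Proof.
move=> e0.
have H1 : \forall y \near +oo, 1 - e < normal_cdf y.
  by apply: (cvgr_gt _ cvg_normal_cdf_y1); rewrite ltrBlDr ltrDl.
have H2 : \forall y \near +oo, x <= y by apply: nbhs_pinfty_ge; exact: num_real.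
near (+oo : set_system R) => y.
exists y; first by near: y; exact: H2.
rewrite ltrBlDr addrC -ltrBlDr.
by near: y; exact: H1.
Unshelve. all: by end_near. Qed.
End tails.

(** * Stein's equation *)

Section stein_solution.
Context {R : realType}.
Notation mu := (@lebesgue_measure R).
Local Notation phi := (@normal_pdf R 0 1).
Variable h : R -> R.
Hypothesis h_cont : continuous h.
Hypothesis h01 : forall x, 0 <= h x <= 1.
Hypothesis h_dec : forall x y, x <= y -> h y <= h x.

Definition normal_mean : R := \int[mu]_t (h t * phi t).
Local Notation c := normal_mean.

Let integrableZ (A : set R) k (u : R -> R) : measurable A -> mu.-integrable A (EFin \o u) ->
  mu.-integrable A (EFin \o (fun t => k * u t)).
Proof. by move=> mA iu; exact: (@integrableZl _ _ _ mu A mA k (EFin \o u)). Qed.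

Lemma integrable_test (A : set R) : measurable A ->
  mu.-integrable A (EFin \o (fun t => h t * phi t)).
Proof.
move=> mA.
have mh : measurable_fun A h.
  by apply: (measurable_funS _ (@subsetT _ A)) => //; exact: continuous_measurable_fun.
apply: (@le_integrable _ _ _ mu A mA _ (EFin \o phi)); last exact: integrable_std_normal_pdf.
  apply/measurable_EFinP; apply: measurable_funM => //.
  exact: (measurable_funS _ (@subsetT _ A) (measurable_normal_pdf 0 1)).
move=> x _ /=; rewrite lee_fin normrM ler_piMl//.
by have /andP[? ?] := h01 x; rewrite ger0_norm.
Qed.

(** Split the integral at [x]: monotonicity puts [h] between [h x] and 1 on the left, and between 0
    and [h x] on the right. At the two ends of a ramp this compares [c] with values of
    [normal_cdf]. *)
Lemma normal_mean_bounds (x : R) :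
  h x * normal_cdf x <= c <= normal_cdf x + h x * (1 - normal_cdf x).
Proof.
have := @Rintegral_itvB R (fun t => h t * phi t) -oo%O +oo%O x.
rewrite set_itvNyy => /(_ (integrable_test measurableT)) /= /(_ isT isT) E.
have {E}-> : c = \int[mu]_(t in `]-oo, x]) (h t * phi t) + \int[mu]_(t in `]x, +oo[) (h t * phi t).
  rewrite -E /c; ring.
rewrite -normal_cdfC normal_cdfE.
have i1 : mu.-integrable `]-oo, x] (EFin \o phi) by exact: integrable_std_normal_pdf.
have i2 : mu.-integrable `]x, +oo[ (EFin \o phi) by exact: integrable_std_normal_pdf.
have i3 : mu.-integrable `]-oo, x] (EFin \o (fun t => h t * phi t)) by exact: integrable_test.
have i4 : mu.-integrable `]x, +oo[ (EFin \o (fun t => h t * phi t)) by exact: integrable_test.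
have p0 t : 0 <= phi t by exact: normal_pdf_ge0.
apply/andP; split.
  rewrite -[leLHS]addr0; apply: lerD.
    rewrite -RintegralZl//; apply: le_Rintegral => //.
      exact: integrableZ.
    by move=> t; rewrite /= in_itv/= => tx; rewrite ler_wpM2r// h_dec.
  by apply: Rintegral_ge0 => t _; rewrite mulr_ge0//; case/andP: (h01 t).
apply: lerD.
  apply: le_Rintegral => // t _.
  by rewrite ler_piMl//; case/andP: (h01 t).
rewrite -RintegralZl//; apply: le_Rintegral => //.
  exact: integrableZ.
by move=> t; rewrite /= in_itv/= andbT => tx; rewrite ler_wpM2r// h_dec// ltW.
Qed.

Lemma normal_mean01 : 0 <= c <= 1.
Proof.
have /andP[a b] := normal_mean_bounds 0.
have := normal_cdf_ge0 (0 : R); have := normal_cdf_le1 (0 : R).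
have /andP[? ?] := h01 0 => *.
apply/andP; split; first by apply: le_trans a; rewrite mulr_ge0.
apply: (le_trans b); nra.
Qed.

Let g t := (h t - c) * phi t.

Let int_g (A : set R) : measurable A -> mu.-integrable A (EFin \o g).
Proof.
move=> mA.
have -> : EFin \o g = (fun t => (h t * phi t)%:E - c%:E * (phi t)%:E)%E.
  by apply/funext => t; rewrite /g; congr (_%:E); ring.
apply: integrableB => //; first exact: integrable_test.
by apply: integrableZl => //; exact: integrable_std_normal_pdf.
Qed.

(** With [phi] as integrating factor, Stein's equation reads [(f phi)' = (h - c) phi = g]; hence [F]
    is [f phi] for the solution [f]. *)
Let F x := \int[mu]_(t in `]-oo, x]) g t.

(** The total integral of [g] is [c - c = 0], so [F] can be computed from either end. *)
Let F_tail x : F x = - \int[mu]_(t in `]x, +oo[) g t.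
Proof.
have := @Rintegral_itvB R g -oo%O +oo%O x.
rewrite set_itvNyy => /(_ (int_g measurableT)) /= /(_ isT isT) <-.
rewrite opprB.
have -> : \int[mu]_t g t = 0; last by rewrite subr0.
have -> : g = (fun t => h t * phi t - c * phi t) by apply/funext => t; rewrite /g; ring.
rewrite RintegralB//.
- rewrite RintegralZl//; last exact: integrable_std_normal_pdf.
  rewrite [X in _ - _ * X](_ : _ = 1) ?mulr1 ?subrr//.
  by rewrite /Rintegral integral_normal_pdf.
- exact: integrable_test.
- by apply: integrableZ => //; exact: integrable_std_normal_pdf.
Qed.

Let g_cont : continuous g.
Proof.
move=> x; apply: cvgM; last by apply: continuous_normal_pdf; exact: oner_neq0.
by apply: (@cvgB _ R^o); [exact: h_cont|exact: cvg_cst].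
Qed.

Let F_derive x : is_derive x (1:R) F (g x).
Proof.
have [] := @continuous_FTC1 R g -oo%O x (x + 1).
- by rewrite ltrDl.
- exact: int_g.
- exact: ltNyr.
- exact: g_cont.
by move=> dF <-; rewrite derive1E; apply: DeriveDef.
Qed.

Let g_le x : g x <= phi x.
Proof.
rewrite /g ler_piMl ?normal_pdf_ge0//.
have /andP[? ?] := h01 x; have /andP[? ?] := normal_mean01; lra.
Qed.
Let g_ge x : - g x <= phi x.
Proof.
rewrite /g -mulNr ler_piMl ?normal_pdf_ge0//.
have /andP[? ?] := h01 x; have /andP[? ?] := normal_mean01; lra.
Qed.

(** This bound and the next one, crude as they are, force [F] to vanish at both infinities, which
    closes the arguments for [F_pos] and [F_neg]. *)
Let F_cdf x : F x <= normal_cdf x.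
Proof.
rewrite normal_cdfE; apply: le_Rintegral => //; [exact: int_g| exact: integrable_std_normal_pdf].
Qed.

Let F_ccdf x : F x <= 1 - normal_cdf x.
Proof.
rewrite -normal_cdfC F_tail -mulN1r -RintegralZl//; last exact: int_g.
apply: le_Rintegral => //; last 2 first.
- exact: integrable_std_normal_pdf.
- by move=> t _; rewrite mulN1r.
by apply: integrableZ => //; exact: int_g.
Qed.

(** As [h] is nonincreasing, [h - c] changes sign at most once, from plus to minus. Either it is
    nonnegative on all of the left of [x], or it is nonpositive on all of the right, where [F_tail]
    applies. *)
Let F_ge0 x : 0 <= F x.
Proof.
have [hc|hc] := leP c (h x).
  apply: Rintegral_ge0 => t; rewrite /= in_itv/= => tx.
  rewrite mulr_ge0 ?normal_pdf_ge0// subr_ge0; apply: (le_trans hc); exact: h_dec.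
rewrite F_tail -mulN1r -RintegralZl//; last exact: int_g.
apply: Rintegral_ge0 => t; rewrite /= in_itv/= andbT => xt.
rewrite mulN1r -mulNr mulr_ge0 ?normal_pdf_ge0// opprB subr_ge0.
by apply: le_trans (ltW hc); apply: h_dec; exact: ltW.
Qed.

(* [F y - c * phi y / y] is nondecreasing on the positive half-line; were it
   positive at [x], [F] would stay bounded below by a positive constant, but
   [F] vanishes at infinity. *)
Let F_pos x : 0 < x -> x * F x <= c * phi x.
Proof.
move=> x0; have /andP[c0 c1] := normal_mean01.
pose G y := F y - c * (phi y * y^-1).
(* Since [(phi y / y)' = - phi y - phi y / y^2], the term [- c * phi y] of [g y] cancels and only
   nonnegative terms remain. *)
have dG (y : R) : 0 < y -> is_derive y (1:R) G (phi y * (h y + c * y^-1 ^+ 2)).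
  move=> y0. 
  have H1 : is_derive y (1:R) (fun y : R => y^-1) (- y^-1 ^+ 2).
    have := @is_deriveV R (fun y : R => y) y 1 1; rewrite gt_eqF// => /(_ isT).
    move=> H; have := H (is_derive_id _ _).
    by rewrite scaler1 exprVn => ?; apply: is_derive_eq.
  have H2 := is_derive_std_normal_pdf y.
  have H3 := is_deriveB (F_derive y) (is_deriveM (is_derive_cst c y 1) (is_deriveM H2 H1)).
  apply: (is_derive_eq H3); rewrite /GRing.scale/= /g; field; lra.
have GG y : x <= y -> G x <= G y.
  rewrite le_eqVlt => /predU1P[->//|xy].
  have dGi z : z \in `]x, y[ -> is_derive z (1:R) G (phi z * (h z + c * z^-1 ^+ 2)).
    by rewrite in_itv/= => /andP[xz _]; apply: dG; lra.
  have cG : {within `[x, y], continuous G}.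
    apply: derivable_within_continuous => z; rewrite in_itv/= => /andP[xz _].
    by have := dG z (lt_le_trans x0 xz) => -[].
  have [z] := MVT xy dGi cG; rewrite in_itv/= => /andP[xz zy] E.
  rewrite -subr_ge0 E mulr_ge0 ?subr_ge0 ?(ltW xy)// mulr_ge0 ?normal_pdf_ge0//.
  have /andP[hz _] := h01 z.
  by rewrite addr_ge0// mulr_ge0// sqr_ge0.
have [Gx|Gx] := leP (G x) 0.
  have : x * G x <= 0 by rewrite mulr_ge0_le0// ltW.
  have -> : x * G x = x * F x - c * phi x by rewrite /G; field; lra.
  lra.
have [y xy ey] := normal_cdfC_small x Gx.
have y0 : 0 < y by lra.
have := GG _ xy; have := F_ccdf y.
have : 0 <= c * (phi y * y^-1) by rewrite !mulr_ge0 ?normal_pdf_ge0// invr_ge0 ltW.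
by rewrite {2}/G; lra.
Qed.

(** Mirror image of [F_pos]: [F y + (1 - c) * phi y / y] is nonincreasing on the negative half-line
    because [h <= 1], so a positive value at [x] would persist towards minus infinity, against
    [F_cdf]. *)
Let F_neg x : x < 0 -> - (1 - c) * phi x <= x * F x.
Proof.
move=> x0; have /andP[c0 c1] := normal_mean01.
pose G y := F y + (1 - c) * (phi y * y^-1).
have dG (y : R) : y < 0 -> is_derive y (1:R) G (phi y * (h y - 1 - (1 - c) * y^-1 ^+ 2)).
  move=> y0. 
  have H1 : is_derive y (1:R) (fun y : R => y^-1) (- y^-1 ^+ 2).
    have := @is_deriveV R (fun y : R => y) y 1 1; rewrite lt_eqF// => /(_ isT).
    move=> H; have := H (is_derive_id _ _).
    by rewrite scaler1 exprVn => ?; apply: is_derive_eq.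
  have H2 := is_derive_std_normal_pdf y.
  have H3 := is_deriveD (F_derive y) (is_deriveM (is_derive_cst (1 - c) y 1) (is_deriveM H2 H1)).
  apply: (is_derive_eq H3); rewrite /GRing.scale/= /g; field; lra.
have GG y : y <= x -> G x <= G y.
  rewrite le_eqVlt => /predU1P[->//|xy].
  have dGi z : z \in `]y, x[ -> is_derive z (1:R) G (phi z * (h z - 1 - (1 - c) * z^-1 ^+ 2)).
    by rewrite in_itv/= => /andP[_ xz]; apply: dG; lra.
  have cG : {within `[y, x], continuous G}.
    apply: derivable_within_continuous => z; rewrite in_itv/= => /andP[_ xz].
    by have := dG z (le_lt_trans xz x0) => -[].
  have [z] := MVT xy dGi cG; rewrite in_itv/= => /andP[xz zy] E.
  rewrite -subr_le0 E mulr_le0_ge0 ?subr_ge0 ?(ltW xy)// mulr_ge0_le0 ?normal_pdf_ge0//.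
  have /andP[? ?] := h01 z; have : 0 <= (1 - c) * z^-1 ^+ 2 by rewrite mulr_ge0 ?sqr_ge0 ?subr_ge0.
  lra.
have [Gx|Gx] := leP (G x) 0.
  have : 0 <= x * G x by rewrite mulr_le0// ltW.
  have -> : x * G x = x * F x + (1 - c) * phi x by rewrite /G; field; lra.
  lra.
have [y xy ey] := normal_cdf_small x Gx.
have y0 : y < 0 by lra.
have := GG _ xy; have := F_cdf y.
have : (1 - c) * (phi y * y^-1) <= 0.
  by rewrite mulr_ge0_le0 ?subr_ge0// mulr_ge0_le0 ?normal_pdf_ge0// invr_le0 ltW.
by rewrite {2}/G; lra.
Qed.

Definition stein_sol x := F x / phi x.
Local Notation f := stein_sol.

(** This is Stein's equation [f' - x f = h - c], from [F' = g] and [(1 / phi)' = x / phi]. *)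
Lemma is_derive_stein_sol x : is_derive x (1:R) f (x * f x + (h x - c)).
Proof.
have px := std_normal_pdf_gt0 x.
have H1 := is_derive_std_normal_pdf x.
have H2 : is_derive x (1:R) (fun y => (phi y)^-1) (x * (phi x)^-1).
  have := @is_deriveV R phi x _ 1; rewrite gt_eqF// => /(_ _ isT H1).
  by move=> ?; apply: is_derive_eq; rewrite /GRing.scale /=; field; lra.
apply: (is_derive_eq (is_deriveM (F_derive x) H2)); rewrite /f /GRing.scale/= /g; field; lra.
Qed.

Lemma stein_sol_ge0 x : 0 <= f x.
Proof. by rewrite divr_ge0// normal_pdf_ge0. Qed.

Lemma stein_sol_xf x : - (1 - c) <= x * f x <= c.
Proof.
have px := std_normal_pdf_gt0 x; have /andP[c0 c1] := normal_mean01.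
have f0 := stein_sol_ge0 x.
have [x0|x0|->] := ltgtP x 0; last by rewrite mul0r; lra.
  apply/andP; split; last by nra.
  by rewrite mulrA ler_pdivlMr// F_neg.
apply/andP; split; first by nra.
by rewrite mulrA ler_pdivrMr// F_pos.
Qed.

(** The sign of [x f] is that of [x]. For [x >= 0] the two terms lie in [[0, c]] and [[-c, 1 - c]];
    for [x < 0] in [[-(1 - c), 0]] and [[-c, 1 - c]]. Both sums stay in [[-1, 1]]. *)
Lemma stein_sol_derive_le x : `|x * f x + (h x - c)| <= 1.
Proof.
have /andP[? ?] := stein_sol_xf x; have /andP[? ?] := normal_mean01; have /andP[? ?] := h01 x.
have f0 := stein_sol_ge0 x.
rewrite ler_norml.
have [x0|x0] := leP 0 x.
  have : 0 <= x * f x by rewrite mulr_ge0.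
  by move=> ?; apply/andP; split; lra.
have : x * f x <= 0 by rewrite mulr_le0_ge0// ltW.
by move=> ?; apply/andP; split; lra.
Qed.

Lemma stein_sol_lip x y : `|f y - f x| <= `|y - x|.
Proof.
wlog xy : x y / x <= y.
  move=> H; have [xy|/ltW yx] := leP x y; first exact: H.
  by rewrite distrC (distrC y); exact: H.
rewrite -[leRHS]mul1r.
have cf : {within `[x, y], continuous f}.
  by apply: derivable_within_continuous => z _; case: (is_derive_stein_sol z).
have [z _ ->] := MVT_segment xy (fun z _ => is_derive_stein_sol z) cf.
by rewrite normrM ler_wpM2r// stein_sol_derive_le.
Qed.

(** For [|x| >= 1] the bound on [x f] gives [f <= 1]. A point of [(-1, 1)] is within distance 1 of
    the endpoint on its own side of 0, where [f <= 1], and [f] is 1-Lipschitz. *)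
Lemma stein_sol_le2 x : f x <= 2.
Proof.
have /andP[A1 A2] := stein_sol_xf x; have /andP[? ?] := normal_mean01.
have f0 := stein_sol_ge0 x.
have [x1|x1] := leP 1 x; first by nra.
have [x2|x2] := leP x (-1); first by nra.
have [x0|/ltW x0] := leP 0 x.
  have := stein_sol_lip x 1; rewrite ler_norml => /andP[+ _].
  rewrite ger0_norm; last lra.
  have /andP[_] := stein_sol_xf 1; lra.
have := stein_sol_lip x (-1); rewrite ler_norml => /andP[+ _].
rewrite ler0_norm; last lra.
have /andP[+ _] := stein_sol_xf (-1); lra.
Qed.

Lemma continuous_stein_sol : continuous f.
Proof.
move=> x; apply: differentiable_continuous; apply/derivable1_diffP.
by case: (is_derive_stein_sol x).
Qed.
End stein_solution.

(** * Bounded random variables and independence *)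

Section bounded_functions.
Context d (T : measurableType d) (R : realType) (P : probability T R).
Implicit Types X Y : T -> R.

(** This class is stable under sums, products and bounded measurable maps and lies inside the
    integrable functions, so that integrability never has to be argued term by term. *)
Definition bounded_mfun X :=
  measurable_fun setT X /\ exists M, forall w, `|X w| <= M.

Definition Rexpectation X : R := \int[P]_w X w.
Local Notation mean := Rexpectation.

Lemma bounded_mfun_integrable X : bounded_mfun X -> P.-integrable setT (EFin \o X).
Proof.
move=> [mX [M XM]].
apply: (@le_integrable _ _ _ P setT measurableT _ (EFin \o cst M)).
- exact/measurable_EFinP.
- move=> w _; rewrite /= lee_fin; apply: (le_trans (XM w)); exact: ler_norm.
- exact: finite_measure_integrable_cst.
Qed.

Lemma bounded_mfun_cst r : bounded_mfun (fun=> r).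
Proof. by split; [exact: measurable_cst|exists `|r|]. Qed.

Lemma bounded_mfunD X Y : bounded_mfun X -> bounded_mfun Y -> bounded_mfun (fun w => X w + Y w).
Proof.
move=> [mX [M XM]] [mY [N YN]]; split; first exact: measurable_funD.
by exists (M + N) => w; apply: (le_trans (ler_normD _ _)); exact: lerD.
Qed.

Lemma bounded_mfunM X Y : bounded_mfun X -> bounded_mfun Y -> bounded_mfun (fun w => X w * Y w).
Proof.
move=> [mX [M XM]] [mY [N YN]]; split; first exact: measurable_funM.
by exists (M * N) => w; rewrite normrM ler_pM.
Qed.

Lemma bounded_mfunN X : bounded_mfun X -> bounded_mfun (fun w => - X w).
Proof.
move=> [mX [M XM]]; split; first exact: (measurableT_comp (@oppr_measurable R setT)).
by exists M => w; rewrite normrN.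
Qed.

Lemma bounded_mfunB X Y : bounded_mfun X -> bounded_mfun Y -> bounded_mfun (fun w => X w - Y w).
Proof. by move=> bX bY; apply: bounded_mfunD => //; exact: bounded_mfunN. Qed.

Lemma bounded_mfunX X n : bounded_mfun X -> bounded_mfun (fun w => X w ^+ n).
Proof.
move=> bX; elim: n => [|n IH]; first exact: bounded_mfun_cst.
have -> : (fun w => X w ^+ n.+1) = (fun w => X w * X w ^+ n).
  by apply/funext => w; rewrite exprS.
exact: bounded_mfunM.
Qed.

Lemma bounded_mfun_norm X : bounded_mfun X -> bounded_mfun (fun w => `|X w|).
Proof.
move=> [mX [M XM]]; split; first exact: measurableT_comp.
by exists M => w; rewrite normr_id.
Qed.

Lemma bounded_mfun_sum (I : Type) (r : seq I) (p : pred I) (F : I -> T -> R) :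
  (forall i, bounded_mfun (F i)) -> bounded_mfun (fun w => \sum_(i <- r | p i) F i w).
Proof.
move=> bF; elim: r => [|i r IH].
  by under eq_fun do rewrite big_nil; exact: bounded_mfun_cst.
under eq_fun do rewrite big_cons.
by case: (p i) => //; apply: bounded_mfunD.
Qed.

Lemma bounded_mfun_comp (g : R -> R) K X :
  measurable_fun setT g -> (forall x, `|g x| <= K) -> bounded_mfun X ->
  bounded_mfun (fun w => g (X w)).
Proof.
move=> mg gK [mX _]; split; last by exists K.
exact: measurableT_comp.
Qed.

Lemma meanD X Y : bounded_mfun X -> bounded_mfun Y ->
  mean (fun w => X w + Y w) = mean X + mean Y.
Proof. by move=> /bounded_mfun_integrable iX /bounded_mfun_integrable iY; exact: RintegralD. Qed.

Lemma meanB X Y : bounded_mfun X -> bounded_mfun Y ->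
  mean (fun w => X w - Y w) = mean X - mean Y.
Proof. by move=> /bounded_mfun_integrable iX /bounded_mfun_integrable iY; exact: RintegralB. Qed.

Lemma meanZ k X : bounded_mfun X -> mean (fun w => k * X w) = k * mean X.
Proof. by move=> /bounded_mfun_integrable iX; exact: RintegralZl. Qed.

Lemma mean_cst r : mean (fun=> r) = r.
Proof. by rewrite /Rexpectation /Rintegral integral_cst//= probability_setT mule1. Qed.

Lemma mean_sum (I : Type) (r : seq I) (p : pred I) (F : I -> T -> R) :
  (forall i, bounded_mfun (F i)) ->
  mean (fun w => \sum_(i <- r | p i) F i w) = \sum_(i <- r | p i) mean (F i).
Proof.
move=> bF; elim: r => [|i r IH].
  by under eq_fun do rewrite big_nil; rewrite mean_cst big_nil.
under eq_fun do rewrite big_cons.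
rewrite big_cons; case: (p i) => //; rewrite -IH meanD//.
exact: bounded_mfun_sum.
Qed.

Lemma le_mean X Y : bounded_mfun X -> bounded_mfun Y ->
  (forall w, X w <= Y w) -> mean X <= mean Y.
Proof.
move=> /bounded_mfun_integrable iX /bounded_mfun_integrable iY XY.
by apply: le_Rintegral => // w _; exact: XY.
Qed.

Lemma mean_ge0 X : (forall w, 0 <= X w) -> 0 <= mean X.
Proof. by move=> X0; apply: Rintegral_ge0. Qed.

Lemma normr_mean_le X : bounded_mfun X -> `|mean X| <= mean (fun w => `|X w|).
Proof. by move=> /bounded_mfun_integrable iX; exact: le_normr_Rintegral. Qed.

Lemma bounded_mfun_indic (A : set T) : measurable A -> bounded_mfun (\1_A : T -> R).
Proof.
move=> mA; split; first exact: measurable_indic.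
by exists 1 => w; rewrite indicE normr_nat lern1 leq_b1.
Qed.

Lemma mean_indic (A : set T) : measurable A -> mean (\1_A : T -> R) = fine (P A).
Proof. by move=> mA; rewrite /Rexpectation /Rintegral integral_indic// setIT. Qed.

(** Independence on rectangles identifies the joint law with the product of the two laws, by
    uniqueness of the product measure. Tonelli factors the mean, and linearity removes the
    shifts. *)
Lemma independent_mean X Y : bounded_mfun X -> bounded_mfun Y ->
  independent_rv P X Y -> mean (fun w => X w * Y w) = mean X * mean Y.
Proof.
move=> bX bY iXY; have [mX [M XM]] := bX; have [mY [N YN]] := bY.
(* Shifted by their bounds, both variables are nonnegative: Tonelli applies. *)
pose a (x : R) := Num.max 0 (x + M); pose b (y : R) := Num.max 0 (y + N).
have a0 x : 0 <= a x by rewrite /a le_max lexx.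
have b0 x : 0 <= b x by rewrite /b le_max lexx.
have aX w : a (X w) = X w + M.
  by apply/max_idPr; have := XM w; rewrite ler_norml => /andP[+ _]; lra.
have bbY w : b (Y w) = Y w + N.
  by apply/max_idPr; have := YN w; rewrite ler_norml => /andP[+ _]; lra.
have ma : measurable_fun setT a.
  by apply: measurable_maxr; [exact: measurable_cst|exact: measurable_funD].
have mb : measurable_fun setT b.
  by apply: measurable_maxr; [exact: measurable_cst|exact: measurable_funD].
have mXY : measurable_fun setT (fun w => (X w, Y w)) by exact: measurable_fun_pair.
pose X' : {mfun T >-> R} := HB.pack X (@isMeasurableFun.Build _ _ _ _ X mX).
pose Y' : {mfun T >-> R} := HB.pack Y (@isMeasurableFun.Build _ _ _ _ Y mY).
pose XY' : {mfun T >-> (R * R)%type} := HB.pack (fun w => (X w, Y w))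
  (@isMeasurableFun.Build _ _ _ _ (fun w => (X w, Y w)) mXY).
pose m1 : probability _ R := distribution P X'.
pose m2 : probability _ R := distribution P Y'.
pose m : probability _ R := distribution P XY'.
have mE (Z : set (R * R)) : measurable Z -> (m1 \x m2)%E Z = m Z.
  apply: (@product_measure_unique _ _ _ _ _ m1 m2 m) => A B mA mB.
  by rewrite /m /m1 /m2 /distribution /pushforward /= -iXY.
have E : (\int[P]_w (a (X w) * b (Y w))%:E =
   (\int[P]_w (a (X w))%:E) * (\int[P]_w (b (Y w))%:E))%E.
  pose f (z : R * R) := (a z.1 * b z.2)%:E.
  have mf : measurable_fun setT f.
    apply/measurable_EFinP; apply: measurable_funM.
      by apply: measurableT_comp ma _; exact: measurable_fst.
    by apply: measurableT_comp mb _; exact: measurable_snd.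
  have f0 z : (0 <= f z)%E by rewrite lee_fin mulr_ge0.
  transitivity (\int[m]_z f z)%E.
    by rewrite ge0_integral_distribution.
  transitivity (\int[(m1 \x m2)%E]_z f z)%E.
    by apply: eq_measure_integral => Z mZ _; symmetry; exact: mE.
  rewrite fubini_tonelli1// /fubini_F /f /=.
  have mEa : measurable_fun setT (EFin \o a) by exact/measurable_EFinP.
  have mEb : measurable_fun setT (EFin \o b) by exact/measurable_EFinP.
  have a0' x : (0 <= (EFin \o a) x)%E by rewrite lee_fin.
  have b0' x : (0 <= (EFin \o b) x)%E by rewrite lee_fin.
  rewrite -[in RHS](@ge0_integral_distribution _ _ _ _ _ P X' _ mEa a0').
  rewrite -[in RHS](@ge0_integral_distribution _ _ _ _ _ P Y' _ mEb b0').
  rewrite -ge0_integralZr//; last by apply: integral_ge0.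
  apply: eq_integral => x _.
  rewrite -ge0_integralZl//.
have bXM : bounded_mfun (fun w => X w + M) by apply: bounded_mfunD => //; exact: bounded_mfun_cst.
have bYN : bounded_mfun (fun w => Y w + N) by apply: bounded_mfunD => //; exact: bounded_mfun_cst.
have E2 : mean (fun w => (X w + M) * (Y w + N)) = mean (fun w => X w + M) * mean (fun w => Y w + N).
  have eX : (fun w => X w + M) = (fun w => a (X w)) by apply/funext => w; rewrite aX.
  have eY : (fun w => Y w + N) = (fun w => b (Y w)) by apply/funext => w; rewrite bbY.
  have eXY : (fun w => (X w + M) * (Y w + N)) = (fun w => a (X w) * b (Y w)).
    by apply/funext => w; rewrite aX bbY.
  rewrite eXY eX eY in bXM bYN *.
  rewrite /Rexpectation /Rintegral E fineM//.
  - by apply: integrable_fin_num => //; exact: bounded_mfun_integrable.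
  - by apply: integrable_fin_num => //; exact: bounded_mfun_integrable.
move: E2.
have -> : (fun w => (X w + M) * (Y w + N)) = (fun w => X w * Y w + (N * X w + (M * Y w + M * N))).
  by apply/funext => w; ring.
have bc r : bounded_mfun (fun=> r) := bounded_mfun_cst r.
have bNX : bounded_mfun (fun w => N * X w) by exact: bounded_mfunM.
have bMY : bounded_mfun (fun w => M * Y w) by exact: bounded_mfunM.
have bXY : bounded_mfun (fun w => X w * Y w) by exact: bounded_mfunM.
have b1 : bounded_mfun (fun w => M * Y w + M * N) by exact: bounded_mfunD.
have b2 : bounded_mfun (fun w => N * X w + (M * Y w + M * N)) by exact: bounded_mfunD.
rewrite !meanD// !meanZ// !mean_cst; lra.
Qed.

End bounded_functions.

(** * Functions of the coordinates in a vertex set *)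

Section dependency.
Context d (T : measurableType d) (R : realType) (P : probability T R).
Context (V : finType) (A : V -> {RV P >-> R}).
Implicit Types (W : {set V}) (U : T -> R).

(** Measurability with respect to the coordinates in [W], expressed as a factorization through
    [random_vector]: events about [U] then become events about that vector. *)
Definition depends_on W U := exists2 g : #|W|.-tuple R -> R,
  measurable_fun setT g & forall w, U w = g (random_vector A W w).

Lemma depends_on_comp W U (g : R -> R) : measurable_fun setT g -> depends_on W U ->
  depends_on W (fun w => g (U w)).
Proof.
move=> mg [k mk kE]; exists (g \o k); first exact: measurableT_comp.
by move=> w; rewrite kE.
Qed.

Lemma depends_on_cst W r : depends_on W (fun=> r).
Proof. by exists (fun=> r). Qed.

Lemma depends_onD W U U' : depends_on W U -> depends_on W U' -> depends_on W (fun w => U w + U' w).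
Proof.
move=> [g mg gE] [k mk kE]; exists (fun x => g x + k x); first exact: measurable_funD.
by move=> w; rewrite gE kE.
Qed.

Lemma depends_onM W U U' : depends_on W U -> depends_on W U' -> depends_on W (fun w => U w * U' w).
Proof.
move=> [g mg gE] [k mk kE]; exists (fun x => g x * k x); first exact: measurable_funM.
by move=> w; rewrite gE kE.
Qed.

Lemma depends_on_coord W v : v \in W -> depends_on W (A v).
Proof.
move=> vW; exists (fun t => tnth t (enum_rank_in vW v)); first exact: measurable_tnth.
by move=> w; rewrite tnth_mktuple enum_rankK_in.
Qed.

Lemma depends_on_sum W (p : pred V) (F : V -> T -> R) :
  (forall v, p v -> depends_on W (F v)) -> depends_on W (fun w => \sum_(v | p v) F v w).
Proof.
move=> dF; elim: (index_enum V) => [|i r IH].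
  by under eq_fun do rewrite big_nil; exact: depends_on_cst.
under eq_fun do rewrite big_cons.
by case E: (p i) => //; apply: depends_onD => //; exact: dF.
Qed.

(** The preimage of a measurable set under [U1] is the preimage under the vector of [W1] of a
    measurable set, and likewise for [U2]; the dependency graph thus makes [U1] and [U2]
    independent. *)
Lemma dependency_graph_mean (G : simple_graph V) W1 W2 U1 U2 :
  dependency_graph A G -> [disjoint W1 & W2]%B ->
  (forall v1 v2, v1 \in W1 -> v2 \in W2 -> ~~ G v1 v2) ->
  depends_on W1 U1 -> depends_on W2 U2 ->
  bounded_mfun U1 -> bounded_mfun U2 ->
  Rexpectation P (fun w => U1 w * U2 w) = Rexpectation P U1 * Rexpectation P U2.
Proof.
move=> dg W12 nG [g mg gE] [k mk kE] b1 b2.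
apply: independent_mean => // B C mB mC.
have -> : U1 = g \o random_vector A W1 by apply/funext.
have -> : U2 = k \o random_vector A W2 by apply/funext.
apply: (dg _ _ W12 nG (g @^-1` B) (k @^-1` C)).
  by have := mg measurableT _ mB; rewrite setTI.
by have := mk measurableT _ mC; rewrite setTI.
Qed.

End dependency.

(** * Stein's method under local dependence *)

(** A second-order remainder where the Lipschitz constant [K] of [f'] is local at [x]. This matters
    because [f'] varies quickly, at rate [1 / lam], only near the window. *)
Lemma taylor1_le (R : realType) (f f' : R -> R) (x y K : R) :
  (forall u, is_derive u (1:R) f (f' u)) ->
  (forall t, `|t| <= `|y| -> `|f' (x + t) - f' x| <= `|t| * K) ->
  `|f (x + y) - f x - y * f' x| <= y ^+ 2 / 2 * K.
Proof.
move=> df lf.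
(* The sign [e] is 1 or -1, one for each side of the absolute value; the last term is chosen so that
   [G e] has nonpositive derivative on []0, 1[]. *)
pose G e (s : R) := e * (f (x + s * y) - s * (y * f' x)) - K * (s ^+ 2 * (y ^+ 2 / 2)).
have dG e (s : R) : is_derive s (1:R) (G e) (e * (y * (f' (x + s * y) - f' x)) - K * (s * y ^+ 2)).
  have H1 : is_derive s (1:R) (fun s : R => x + s * y) y.
    by apply: is_derive_eq; rewrite /GRing.scale/=; ring.
  have H2 := @is_derive1_comp _ f (fun s : R => x + s * y) s _ _ (df _) H1.
  have H3 : is_derive s (1:R) (fun s : R => s * (y * f' x)) (y * f' x).
    by apply: is_derive_eq; rewrite /GRing.scale/=; ring.
  have H4 : is_derive s (1:R) (fun s : R => K * (s ^+ 2 * (y ^+ 2 / 2))) (K * (s * y ^+ 2)).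
    by apply: is_derive_eq; rewrite /GRing.scale/=; field.
  have H5 := is_deriveB (is_deriveM (is_derive_cst e s 1) (is_deriveB H2 H3)) H4.
  by apply: (is_derive_eq H5); rewrite /GRing.scale/=; ring.
have G01 e : `|e| = 1 -> G e 1 <= G e 0.
  move=> e1.
  have cG : {within `[0, 1], continuous (G e)}.
    by apply: derivable_within_continuous => z _; case: (dG e z).
  have [z] := MVT ltr01 (fun z _ => dG e z) cG.
  rewrite in_itv/= => /andP[z0 z1] E.
  rewrite -subr_le0 E subr0 mulr1 subr_le0.
  apply: (le_trans (ler_norm _)); rewrite normrM e1 mul1r normrM.
  have := lf (z * y); rewrite normrM (gtr0_norm z0) => /(_ (ler_piMl (normr_ge0 _) (ltW z1))) H.
  have := ler_wpM2l (normr_ge0 y) H.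
  have -> : `|y| * (z * `|y| * K) = K * (z * `|y| ^+ 2) by ring.
  by rewrite real_normK ?num_real.
have := G01 1 (normr1 _); have := G01 (-1); rewrite normrN1 => /(_ erefl).
rewrite /G !mul0r !mul1r !addr0 expr0n expr1n /= => H1 H2.
rewrite ler_norml; apply/andP; split; lra.
Qed.

(** * Second moments of sums with few correlated pairs *)

Section second_moment.
Context d (T : measurableType d) (R : realType) (P : probability T R).
Local Notation mean := (Rexpectation P).

(** Expand the square. Unlinked pairs contribute 0, a linked pair at most the average of its two
    second moments, and each index has at most [k] linked partners. *)
Lemma mean_sqr_sum_le (I : finType) (S : pred I) (L : rel I) (xi : I -> T -> R) (k : nat) :
  symmetric L -> (forall i, bounded_mfun (xi i)) ->
  (forall i j, S i -> S j -> ~~ L i j -> mean (fun w => xi i w * xi j w) = 0) ->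
  (forall i, S i -> (#|[pred j | S j && L i j]| <= k)%N) ->
  mean (fun w => (\sum_(i | S i) xi i w) ^+ 2) <= k%:R * \sum_(i | S i) mean (fun w => xi i w ^+ 2).
Proof.
move=> symL bxi L0 Lk.
have bM i j : bounded_mfun (fun w => xi i w * xi j w) by exact: bounded_mfunM.
pose a i := mean (fun w => xi i w ^+ 2).
have a0 i : 0 <= a i by apply: mean_ge0 => w; exact: sqr_ge0.
have -> : mean (fun w => (\sum_(i | S i) xi i w) ^+ 2) =
   \sum_(i | S i) \sum_(j | S j) mean (fun w => xi i w * xi j w).
  have -> : (fun w => (\sum_(i | S i) xi i w) ^+ 2) =
     (fun w => \sum_(i | S i) \sum_(j | S j) xi i w * xi j w).
    by apply/funext => w; rewrite expr2 big_distrlr.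
  rewrite mean_sum; last by move=> i; apply: bounded_mfun_sum.
  by apply: eq_bigr => i _; rewrite mean_sum.
have bX2 i : bounded_mfun (fun w => xi i w ^+ 2) by exact: bounded_mfunX.
have bS i j : bounded_mfun (fun w => xi i w ^+ 2 + xi j w ^+ 2) by exact: bounded_mfunD.
have le1 i j : mean (fun w => xi i w * xi j w) <= (a i + a j) / 2.
  have -> : (a i + a j) / 2 = mean (fun w => 2^-1 * (xi i w ^+ 2 + xi j w ^+ 2)).
    by rewrite meanZ// meanD// mulrC.
  apply: le_mean => //.
    apply: bounded_mfunM; first exact: bounded_mfun_cst.
    exact: bS.
  move=> w; have := sqr_ge0 (xi i w - xi j w); lra.
apply: (@le_trans _ _ (\sum_(i | S i) \sum_(j | S j && L i j) (a i + a j) / 2)).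
  apply: ler_sum => i Si; rewrite (bigID (L i))/= [X in _ + X]big1 ?addr0.
    by apply: ler_sum => j _; exact: le1.
  by move=> j /andP[Sj nL]; exact: L0.
(* As [L] is symmetric, exchanging the sums shows that the [a j] contribute as much as the [a i]. *)
have -> : \sum_(i | S i) \sum_(j | S j && L i j) (a i + a j) / 2 =
   \sum_(i | S i) \sum_(j | S j && L i j) a i.
  have E : \sum_(i | S i) \sum_(j | S j && L i j) a j = \sum_(i | S i) \sum_(j | S j && L i j) a i.
    rewrite (exchange_big_dep S)/=; last by move=> i j _ /andP[].
    by apply: eq_bigr => j Sj; apply: eq_bigl => i; rewrite symL Sj.
  under eq_bigr do (rewrite -mulr_suml big_split/=).
  by rewrite -mulr_suml big_split/= E; lra.
rewrite mulr_sumr; apply: ler_sum => i Si.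
rewrite sumr_const -[leLHS]mulr_natl ler_wpM2r// ler_nat.
exact: Lk.
Qed.
End second_moment.

(** * Stein's bound for a locally dependent sum *)

Section core.
Context d (T : measurableType d) (R : realType) (P : probability T R).
Context (V : finType) (A : V -> {RV P >-> R}) (G : simple_graph V).
Local Notation mean := (Rexpectation P).
Variables (X : V -> T -> R) (beta q m : R) (D : nat).
Hypothesis dG : dependency_graph A G.
Hypothesis Xdep : forall (W : {set V}) v, v \in W -> depends_on A W (X v).
Hypothesis Xmeas : forall v, measurable_fun setT (X v).
Hypothesis Xbeta : forall v w, `|X v w| <= beta.
Hypothesis Xmean : forall v, mean (X v) = 0.
Hypothesis Xq : \sum_v mean (fun w => X v w ^+ 2) <= q.
Hypothesis Xm : \sum_v mean (fun w => `|X v w|) <= m.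

Definition closed_nbhd v : {set V} := [set u | (u == v) || G v u].
Local Notation N := closed_nbhd.
Hypothesis ND : forall v, (#|N v| <= D)%N.
Let W w := \sum_v X v w.
Hypothesis varW : mean (fun w => W w ^+ 2) = 1.

Let bX v : bounded_mfun (X v). Proof. by split; [exact: Xmeas|exists beta]. Qed.
Let bW : bounded_mfun W. Proof. exact: bounded_mfun_sum. Qed.

Lemma closed_nbhd_sym v u : (u \in N v) = (v \in N u).
Proof. by rewrite !inE eq_sym edge_sym. Qed.

(** Since [N v] contains [v] itself, the single condition [v2 \notin N v1] encodes both disjointness
    and the absence of edges. *)
Let mean_indep (W1 W2 : {set V}) U1 U2 :
  (forall v1 v2, v1 \in W1 -> v2 \in W2 -> v2 \notin N v1) ->
  depends_on A W1 U1 -> depends_on A W2 U2 -> bounded_mfun U1 -> bounded_mfun U2 ->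
  mean (fun w => U1 w * U2 w) = mean U1 * mean U2.
Proof.
move=> H; apply: (dependency_graph_mean dG).
  rewrite disjoint_subset; apply/fintype.subsetP => v v1; rewrite inE; apply/negP => v2.
  by have := H v v v1 v2; rewrite inE eqxx.
move=> v1 v2 v1W v2W; have := H v1 v2 v1W v2W.
by rewrite inE negb_or => /andP[].
Qed.

Lemma mean_prod0 v u : u \notin N v -> mean (fun w => X v w * X u w) = 0.
Proof.
move=> nuv; rewrite (@mean_indep [set v] [set u])//; first by rewrite Xmean mul0r.
- by move=> v1 v2 /set1P-> /set1P->.
- by apply: Xdep; rewrite inE.
- by apply: Xdep; rewrite inE.
Qed.

(** The variance 1 of [W] is bounded by counting neighbours. This lower bound on [D * q] is what
    later absorbs all error terms into one multiple of [eps]. *)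
Lemma le_var_deg : 1 <= D%:R * q.
Proof.
rewrite -[X in X <= _]varW; apply: (le_trans _ (ler_wpM2l (ler0n _ D) Xq)).
apply: (@mean_sqr_sum_le _ _ _ _ _ predT (fun v u => u \in N v)) => //.
- by move=> v u; exact: closed_nbhd_sym.
- by move=> v u _ _; exact: mean_prod0.
- by move=> v _; apply: leq_trans (ND v); rewrite (@eq_card _ _ (mem (N v))).
Qed.

Let Q w := \sum_v \sum_(u in N v) X v w * X u w.

Let bXX v u : bounded_mfun (fun w => X v w * X u w). Proof. exact: bounded_mfunM. Qed.
Let bQ : bounded_mfun Q.
Proof. by apply: bounded_mfun_sum => v; apply: bounded_mfun_sum. Qed.

(** The centred products; over the ordered pairs in [S], loops included, they sum to [Q - 1]. *)
Let xi (p : V * V) w := X p.1 w * X p.2 w - mean (fun w => X p.1 w * X p.2 w).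
Let S (p : V * V) := p.2 \in N p.1.
(** When this fails, the endpoints of [p] and those of [r] share no vertex and no edge, so [xi p]
    and [xi r] are independent. *)
Let linked (p r : V * V) := [|| r.1 \in N p.1, r.1 \in N p.2, r.2 \in N p.1 | r.2 \in N p.2].

Let QE w : Q w - 1 = \sum_(p | S p) xi p w.
Proof.
rewrite /xi -varW sumrB; congr (_ - _).
  by rewrite /Q pair_big_dep.
have -> : (fun w => W w ^+ 2) = (fun w => \sum_v \sum_u X v w * X u w).
  by apply/funext => w'; rewrite expr2 /W big_distrlr.
rewrite mean_sum; last by move=> v; exact: bounded_mfun_sum.
rewrite -(pair_big_dep xpredT (fun v u => u \in N v) (fun v u => mean (fun w => X v w * X u w)))/=.
apply: eq_bigr => v _; rewrite mean_sum// (bigID (mem (N v)))/= [X in _ + X]big1 ?addr0//.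
by move=> u; exact: mean_prod0.
Qed.

Let card_S_fst a : (#|[pred p : V * V | S p && (p.1 \in N a)]| <= D * D)%N.
Proof.
rewrite -sum1_card (eq_bigl (fun p : V * V => (p.1 \in N a) && (p.2 \in N p.1))); last first.
  by move=> p; rewrite inE andbC.
rewrite -(pair_big_dep (mem (N a)) (fun v u => u \in N v) (fun _ _ => 1%N))/=.
apply: (@leq_trans (\sum_(v in N a) D)).
  by apply: leq_sum => v _; rewrite sum1_card.
by rewrite sum_nat_const leq_mul2r ND orbT.
Qed.

(** Swapping coordinates preserves [S], which reduces the count to [card_S_fst]. *)
Let card_S_snd a : (#|[pred p : V * V | S p && (p.2 \in N a)]| <= D * D)%N.
Proof.
apply: leq_trans (card_S_fst a).
have swap_inj : injective (fun p : V * V => (p.2, p.1)) by move=> [? ?] [? ?] [-> ->].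
rewrite -[leqLHS](fintype.card_image swap_inj).
apply/subset_leq_card/fintype.subsetP => p /fintype.imageP[[v u] vu ->].
have /andP[Sp ua] : S (v, u) && (u \in N a) by exact: vu.
have : S (u, v) && (u \in N a) by rewrite ua andbT /S/= closed_nbhd_sym.
exact.
Qed.

(** A pair is linked to at most [4 D^2] others: four possible adjacencies, [D^2] pairs for each. The
    second moments of the [xi p] add up to at most [D beta^2 q], each vertex being first in at most
    [D] pairs. *)
Lemma mean_sqr_dev_le : mean (fun w => (Q w - 1) ^+ 2) <= 4 * D%:R ^+ 3 * beta ^+ 2 * q.
Proof.
have bxi p : bounded_mfun (xi p) by apply: bounded_mfunB => //; exact: bounded_mfun_cst.
under eq_fun do rewrite QE.
have symL : symmetric linked.
  move=> p r; rewrite /linked !(closed_nbhd_sym p.1) !(closed_nbhd_sym p.2).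
  by do 4 case: (_ \in _).
have mean_xi p : mean (xi p) = 0.
  by rewrite /xi meanB ?mean_cst ?subrr//; exact: bounded_mfun_cst.
have xi0 p r : S p -> S r -> ~~ linked p r -> mean (fun w => xi p w * xi r w) = 0.
  move=> _ _; rewrite /linked !negb_or => /and4P[n1 n2 n3 n4].
  have dxi (p' : V * V) : depends_on A [set p'.1; p'.2] (xi p').
    apply: depends_onD; last exact: depends_on_cst.
    by apply: depends_onM; apply: Xdep; rewrite !inE eqxx ?orbT.
  rewrite (@mean_indep [set p.1; p.2] [set r.1; r.2])// ?mean_xi ?mul0r//.
  by move=> v1 v2 /set2P[->|->] /set2P[->|->].
have Lk p : S p -> (#|[pred r | S r && linked p r]| <= 4 * D ^ 2)%N.
  move=> _.
  pose near1 a := [pred r : V * V | S r && (r.1 \in N a)].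
  pose near2 a := [pred r : V * V | S r && (r.2 \in N a)].
  apply: (@leq_trans (#|[predU [predU near1 p.1 & near1 p.2]
                             & [predU near2 p.1 & near2 p.2]]|)).
    apply/subset_leq_card/fintype.subsetP => r H.
    have /andP[Sr /or4P lr] : S r && linked p r by exact: H.
    suff : ((S r && (r.1 \in N p.1)) || (S r && (r.1 \in N p.2))) ||
      ((S r && (r.2 \in N p.1)) || (S r && (r.2 \in N p.2))) by exact.
    by rewrite Sr /=; case: lr => ->; rewrite ?orbT.
  have cU (B C : pred (V * V)) n k : (#|B| <= n -> #|C| <= k -> #|[predU B & C]| <= n + k)%N.
    move=> Bn Ck; apply: leq_trans (leq_add Bn Ck).
    by rewrite -(cardUI B C) leq_addr.
  have -> : (4 * D ^ 2 = (D * D + D * D) + (D * D + D * D))%N.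
    by rewrite -mulnn; ring.
  by apply/cU; apply/cU; rewrite ?card_S_fst ?card_S_snd.
apply: (le_trans (mean_sqr_sum_le symL bxi xi0 Lk)).
(* A variance is at most the second moment, and [|X p.2|] is at most [beta]. *)
have xi_le p : mean (fun w => xi p w ^+ 2) <= beta ^+ 2 * mean (fun w => X p.1 w ^+ 2).
  set c := mean (fun w => X p.1 w * X p.2 w).
  have bX2 v : bounded_mfun (fun w => X v w ^+ 2) by exact: bounded_mfunX.
  have bXX2 : bounded_mfun (fun w => (X p.1 w * X p.2 w) ^+ 2) by exact: bounded_mfunX.
  have -> : (fun w => xi p w ^+ 2) = (fun w => (X p.1 w * X p.2 w) ^+ 2 -
      ((2 * c) * (X p.1 w * X p.2 w) - c ^+ 2)).
    by apply/funext => w; rewrite /xi -/c; ring.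
  have bc (r : R) : bounded_mfun (fun _ : T => r) := bounded_mfun_cst T r.
  have b1 : bounded_mfun (fun w => (2 * c) * (X p.1 w * X p.2 w)) by exact: bounded_mfunM.
  have b2 : bounded_mfun (fun w => (2 * c) * (X p.1 w * X p.2 w) - c ^+ 2) by exact: bounded_mfunB.
  rewrite !meanB// meanZ// mean_cst -/c -meanZ//.
  have H : mean (fun w => (X p.1 w * X p.2 w) ^+ 2) <= mean (fun w => beta ^+ 2 * X p.1 w ^+ 2).
    apply: le_mean => //; first exact: bounded_mfunM.
    move=> w; rewrite exprMn mulrC ler_wpM2r ?sqr_ge0//.
    rewrite -[leLHS]real_normK ?num_real// lerXn2r ?nnegrE//.
    by apply: le_trans (Xbeta p.1 w).
  have := sqr_ge0 c; lra.
have -> : 4 * D%:R ^+ 3 * beta ^+ 2 * q = (4 * D ^ 2)%:R * (D%:R * beta ^+ 2 * q).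
  by rewrite natrM natrX; ring.
rewrite ler_wpM2l//.
apply: (@le_trans _ _ (\sum_(p | S p) beta ^+ 2 * mean (fun w => X p.1 w ^+ 2))).
  by apply: ler_sum => p _.
rewrite -(pair_big_dep xpredT (fun v u => u \in N v)
  (fun v u => beta ^+ 2 * mean (fun w => X v w ^+ 2)))/=.
apply: (@le_trans _ _ (\sum_v D%:R * (beta ^+ 2 * mean (fun w => X v w ^+ 2)))).
  apply: ler_sum => v _; rewrite sumr_const -[leLHS]mulr_natl ler_wpM2r ?ler_nat//.
  by rewrite mulr_ge0 ?sqr_ge0//; apply: mean_ge0 => w; exact: sqr_ge0.
rewrite -mulr_sumr -mulr_sumr mulrA ler_wpM2l//.
by apply: mulr_ge0; [exact: ler0n|exact: sqr_ge0].
Qed.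

Let Y v w := \sum_(u in N v) X u w.
Let Wc v w := \sum_(u in ~: N v) X u w.

Let WE v w : W w = Wc v w + Y v w.
Proof.
rewrite /W (bigID (mem (N v)))/= addrC; congr (_ + _).
by apply: eq_bigl => u; rewrite finset.in_setC.
Qed.

Let delta := D%:R * beta.

Let Y_le v w : `|Y v w| <= delta.
Proof.
apply: (le_trans (ler_norm_sum _ _ _)).
apply: (@le_trans _ _ (\sum_(u in N v) beta)); first exact: ler_sum.
rewrite sumr_const -[leLHS]mulr_natl ler_wpM2r ?ler_nat//.
exact: le_trans (Xbeta v w).
Qed.

Variables (f f' : R -> R) (z lam theta : R).
Hypothesis lam0 : 0 < lam.
Hypothesis delta0 : 0 <= delta.
Hypothesis f_der : forall x, is_derive x (1:R) f (f' x).
Hypothesis f_meas : measurable_fun setT f.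
Hypothesis f'_meas : measurable_fun setT f'.
Hypothesis f_le : forall x, `|f x| <= 2.
Hypothesis f'_le : forall x, `|f' x| <= 1.
(** The interval where the ramp is not flat, enlarged by [k] times the bound [delta] on [|Y v|]. The
    local estimate on [f'] uses [k = 1]; passing from [W] to [Wc v] and then back to [W] raises it
    to 2 and 3. *)
Let I k : set R := `[z - k * delta, z + lam + k * delta].
Hypothesis f'_lip : forall x t, `|t| <= delta ->
  `|f' (x + t) - f' x| <= `|t| * (2 + `|x| + lam^-1 * \1_(I 1) x).
Hypothesis theta0 : 0 < theta.
Hypothesis thetaE : 4 * D%:R ^+ 3 * beta ^+ 2 * q <= theta ^+ 2.

Let bWc v : bounded_mfun (Wc v). Proof. exact: bounded_mfun_sum. Qed.
Let bY v : bounded_mfun (Y v). Proof. exact: bounded_mfun_sum. Qed.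
Let bf (U : T -> R) : bounded_mfun U -> bounded_mfun (fun w => f (U w)).
Proof. exact: bounded_mfun_comp f_meas f_le. Qed.
Let bf' (U : T -> R) : bounded_mfun U -> bounded_mfun (fun w => f' (U w)).
Proof. exact: bounded_mfun_comp f'_meas f'_le. Qed.

Let mI k : measurable (I k). Proof. exact: measurable_itv. Qed.
Let bI k (U : T -> R) : bounded_mfun U -> bounded_mfun (fun w => \1_(I k) (U w) : R).
Proof.
move=> bU; apply: (@bounded_mfun_comp _ _ _ (\1_(I k)) 1) => // x.
by rewrite indicE normr_nat lern1 leq_b1.
Qed.

Let depWc v : depends_on A (~: N v) (Wc v).
Proof. by apply: depends_on_sum => u uN; exact: Xdep. Qed.

Let indep_v v (g1 g2 : T -> R) : depends_on A [set v] g1 -> depends_on A (~: N v) g2 ->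
  bounded_mfun g1 -> bounded_mfun g2 -> mean (fun w => g1 w * g2 w) = mean g1 * mean g2.
Proof.
by apply: mean_indep => v1 v2 /set1P ->; rewrite finset.in_setC.
Qed.

(** The expansion is made at [W], not at [Wc v], so that the main term [Q * f' (W)] has the same
    argument as [f' (W)]. *)
Let Rem v w := f (W w) - f (Wc v w) - Y v w * f' (W w).

Let bRem v : bounded_mfun (Rem v).
Proof.
apply: bounded_mfunB; first by apply: bounded_mfunB; exact: bf.
by apply: bounded_mfunM => //; exact: bf'.
Qed.

(** Written in terms of [Wc v] only, hence independent of [X v]: the mean of [|X v| * Kfun v]
    factors. *)
Let Kfun v w := 2 + delta + `|Wc v w| + lam^-1 * \1_(I 2) (Wc v w).

Let bKfun v : bounded_mfun (Kfun v).
Proof.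
apply: bounded_mfunD.
  by apply: bounded_mfunD; [exact: bounded_mfun_cst|exact: bounded_mfun_norm].
by apply: bounded_mfunM; [exact: bounded_mfun_cst|exact: bI].
Qed.

Let Rem_le v w : `|Rem v w| <= delta ^+ 2 / 2 * Kfun v w.
Proof.
(* Taylor at [W] with increment [- Y v], which leads to [Wc v]. *)
have /(_ (W w) (- Y v w)) := @taylor1_le _ f f' _ _ (2 + `|W w| + lam^-1 * \1_(I 1) (W w)) f_der.
rewrite normrN.
have -> : f (W w + - Y v w) - f (W w) - - Y v w * f' (W w) = - Rem v w.
  by rewrite /Rem (WE v w) addrK; ring.
rewrite normrN sqrrN => H.
apply: (le_trans (H _)).
  by move=> t tY; apply: f'_lip; apply: le_trans tY _.
apply: ler_pM.
- by rewrite divr_ge0 ?sqr_ge0.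
- by rewrite !addr_ge0// mulr_ge0 ?invr_ge0 ?(ltW lam0)// indicE.
- rewrite ler_pM2r ?invr_gt0// -[leLHS]real_normK ?num_real// lerXn2r ?nnegrE//.
have Yd := Y_le v w.
have -> : Kfun v w = 2 + (`|Wc v w| + delta) + lam^-1 * \1_(I 2) (Wc v w) by rewrite /Kfun; ring.
apply: lerD.
  rewrite lerD2l (WE v w); apply: (le_trans (ler_normD _ _)); lra.
rewrite ler_wpM2l ?invr_ge0 ?(ltW lam0)// !indicE ler_nat.
case: (boolP (W w \in I 1)) => // WI.
suff -> : Wc v w \in I 2 by [].
move: WI; rewrite !inE /I /= !in_itv/= (WE v w).
move: Yd; rewrite ler_norml => /andP[? ?] /andP[? ?]; apply/andP; split; lra.
Qed.

Let mean_absW : mean (fun w => `|W w|) <= 1.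
Proof.
have b2 : bounded_mfun (fun w => W w ^+ 2) by exact: bounded_mfunX.
have bc (r : R) : bounded_mfun (fun _ : T => r) := bounded_mfun_cst T r.
have b3 : bounded_mfun (fun w => W w ^+ 2 + 1) by exact: bounded_mfunD.
have -> : 1 = mean (fun w => 2^-1 * (W w ^+ 2 + 1)).
  by rewrite meanZ// meanD// varW mean_cst; lra.
apply: le_mean; [exact: bounded_mfun_norm|exact: bounded_mfunM|].
move=> w; have := sqr_ge0 (`|W w| - 1); rewrite sqrrB expr1n real_normK ?num_real//; lra.
Qed.

Definition window_prob := fine (P (W @^-1` `[z - 3 * delta, z + lam + 3 * delta])).

(** Going back from [Wc v] to [W] costs another [delta] in both places, and the mean of [|W|] is at
    most 1. *)
Let mean_Kfun v : mean (Kfun v) <= 3 + 2 * delta + lam^-1 * window_prob.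
Proof.
have mW : measurable (W @^-1` I 3).
  by have [mW _] := bW; have := mW measurableT _ (mI 3); rewrite setTI.
have bc (r : R) : bounded_mfun (fun _ : T => r) := bounded_mfun_cst T r.
have bi : bounded_mfun (\1_(W @^-1` I 3) : T -> R) by exact: bounded_mfun_indic.
have bi' : bounded_mfun (fun w => lam^-1 * (\1_(W @^-1` I 3) w : R)) by exact: bounded_mfunM.
have bn : bounded_mfun (fun w => `|W w|) by exact: bounded_mfun_norm.
have bn' : bounded_mfun (fun w => 2 + 2 * delta + `|W w|) by exact: bounded_mfunD.
apply: (@le_trans _ _ (mean (fun w => (2 + 2 * delta + `|W w|) + lam^-1 * \1_(W @^-1` I 3) w))).
  apply: le_mean => //; first exact: bounded_mfunD.
  move=> w; have Yd := Y_le v w.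
  apply: lerD.
    suff : `|Wc v w| <= `|W w| + delta by lra.
    have -> : Wc v w = W w - Y v w by rewrite (WE v w) addrK.
    by apply: (le_trans (ler_normB _ _)); lra.
  rewrite ler_wpM2l ?invr_ge0 ?(ltW lam0)// !indicE ler_nat.
  case: (boolP (Wc v w \in I 2)) => // WI.
  suff -> : w \in W @^-1` I 3 by [].
  move: WI; rewrite !inE /I /= !in_itv/= (WE v w).
  move: Yd; rewrite ler_norml => /andP[? ?] /andP[? ?]; apply/andP; split; lra.
rewrite !meanD// !mean_cst (@meanZ _ _ _ _ lam^-1 (\1_(W @^-1` I 3)))// mean_indic//.
have := mean_absW; rewrite /window_prob -/(I 3); lra.
Qed.

(** Since [X v] is centred and independent of [Wc v], the mean of [W f(W)] is that of [Q f'(W)] plus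
    those of the [X v * Rem v]. The difference is thus the mean of [(1 - Q) f'(W)], at most [theta],
    minus the remainders. *)
Lemma stein_local_dependence :
  `|mean (fun w => f' (W w)) - mean (fun w => W w * f (W w))| <=
  theta + delta ^+ 2 / 2 * m * (3 + 2 * delta + lam^-1 * window_prob).
Proof.
have bc (r : R) : bounded_mfun (fun _ : T => r) := bounded_mfun_cst T r.
have bfW := bf bW; have bf'W := bf' bW.
have E1 : mean (fun w => W w * f (W w)) =
   mean (fun w => Q w * f' (W w)) + \sum_v mean (fun w => X v w * Rem v w).
  have -> : (fun w => W w * f (W w)) = (fun w => \sum_v X v w * f (W w)).
    by apply/funext => w; rewrite mulr_suml.
  rewrite mean_sum; last by move=> v; exact: bounded_mfunM.
  have -> : (fun w => Q w * f' (W w)) = (fun w => \sum_v X v w * (Y v w * f' (W w))).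
    apply/funext => w; rewrite /Q mulr_suml; apply: eq_bigr => v _.
    by rewrite /Y mulrA; congr (_ * _); rewrite mulr_sumr.
  have bYf v : bounded_mfun (fun w => Y v w * f' (W w)) by exact: bounded_mfunM.
  rewrite mean_sum; last by move=> v; exact: bounded_mfunM.
  rewrite -big_split/=; apply: eq_bigr => v _.
  rewrite -meanD; [|exact: bounded_mfunM|exact: bounded_mfunM].
  have -> : (fun w => X v w * f (W w)) =
     (fun w => X v w * f (Wc v w) + (X v w * (Y v w * f' (W w)) + X v w * Rem v w)).
    by apply/funext => w; rewrite /Rem; ring.
  have bXf : bounded_mfun (fun w => X v w * f (Wc v w)) by apply: bounded_mfunM => //; exact: bf.
  have bXY : bounded_mfun (fun w => X v w * (Y v w * f' (W w))) by exact: bounded_mfunM.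
  have bXR : bounded_mfun (fun w => X v w * Rem v w) by exact: bounded_mfunM.
  have bXYR : bounded_mfun (fun w => X v w * (Y v w * f' (W w)) + X v w * Rem v w).
    exact: bounded_mfunD.
  rewrite (meanD P bXf bXYR).
  rewrite (@indep_v v (X v) (fun w => f (Wc v w)))//.
  - by rewrite Xmean mul0r add0r.
  - by apply: Xdep; rewrite inE.
  - exact: depends_on_comp.
  - exact: bf.
have bQf : bounded_mfun (fun w => Q w * f' (W w)) by exact: bounded_mfunM.
rewrite E1 opprD addrA -meanB//.
apply: (le_trans (ler_normB _ _)); apply: lerD.
  have bQ1 : bounded_mfun (fun w => (Q w - 1) ^+ 2).
    by apply: bounded_mfunX; exact: bounded_mfunB.
  apply: (le_trans (normr_mean_le _ _)); first exact: bounded_mfunB.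
  have bb : bounded_mfun (fun w => (Q w - 1) ^+ 2 + theta ^+ 2) by exact: bounded_mfunD.
  (* In place of the Cauchy-Schwarz inequality: [|Q - 1| <= ((Q - 1)^2 + theta^2) / (2 theta)],
     whose mean is at most [theta]. *)
  apply: (@le_trans _ _ (mean (fun w => (2 * theta)^-1 * ((Q w - 1) ^+ 2 + theta ^+ 2)))).
    apply: le_mean; [|exact: bounded_mfunM|].
      by apply: bounded_mfun_norm; exact: bounded_mfunB.
    move=> w.
    have -> : f' (W w) - Q w * f' (W w) = - ((Q w - 1) * f' (W w)) by ring.
    rewrite normrN normrM; apply: (@le_trans _ _ `|Q w - 1|); first by rewrite ler_piMr.
    rewrite mulrC ler_pdivlMr ?mulr_gt0//.
    have := sqr_ge0 (`|Q w - 1| - theta); rewrite sqrrB real_normK ?num_real//; lra.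
  rewrite meanZ// meanD// mean_cst mulrC ler_pdivrMr ?mulr_gt0//.
  have := le_trans mean_sqr_dev_le thetaE; rewrite -/Q; lra.
apply: (le_trans (ler_norm_sum _ _ _)).
have bXn v : bounded_mfun (fun w => `|X v w|) by exact: bounded_mfun_norm.
apply: (@le_trans _ _ (\sum_v delta ^+ 2 / 2 *
  (3 + 2 * delta + lam^-1 * window_prob) * mean (fun w => `|X v w|))).
  apply: ler_sum => v _.
  apply: (le_trans (normr_mean_le _ _)); first exact: bounded_mfunM.
  have bXK : bounded_mfun (fun w => `|X v w| * Kfun v w) by exact: bounded_mfunM.
  apply: (@le_trans _ _ (mean (fun w => delta ^+ 2 / 2 * (`|X v w| * Kfun v w)))).
    apply: le_mean; [|exact: bounded_mfunM|].
      by apply: bounded_mfun_norm; exact: bounded_mfunM.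
    by move=> w; rewrite normrM mulrCA ler_wpM2l.
  rewrite meanZ// -[leRHS]mulrA ler_wpM2l ?divr_ge0 ?sqr_ge0//.
  rewrite (@indep_v v (fun w => `|X v w|) (Kfun v))//.
  - by rewrite mulrC ler_wpM2r//; apply: mean_ge0.
  - apply: depends_on_comp => //; apply: Xdep; by rewrite inE.
  - apply: depends_onD; last first.
      apply: depends_onM; first exact: depends_on_cst.
      by apply: (@depends_on_comp _ _ _ _ _ _ _ _ (\1_(I 2))).
    apply: depends_onD; first exact: depends_on_cst.
    by apply: depends_on_comp.
rewrite -mulr_sumr [leRHS]mulrAC ler_wpM2l//.
have wp0 : 0 <= window_prob by exact: fine_ge0.
have lam1 : 0 <= lam^-1 by rewrite invr_ge0 ltW.
apply: mulr_ge0; first by rewrite divr_ge0 ?sqr_ge0.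
apply: addr_ge0; last exact: mulr_ge0.
by apply: addr_ge0 => //; exact: (mulr_ge0 _ delta0).
Qed.
End core.

(** * From smooth test functions to the Kolmogorov distance *)

Section ramp.
Context {R : realType}.
Variables (z lam : R).
Hypothesis lam0 : 0 < lam.

Definition ramp (x : R) := Num.min 1 (Num.max 0 ((z + lam - x) / lam)).

Lemma ramp01 x : 0 <= ramp x <= 1.
Proof. by rewrite /ramp le_min ler01 le_max lexx ge_min lexx. Qed.

Lemma ramp_le x y : x <= y -> ramp y <= ramp x.
Proof.
move=> xy; have H : (z + lam - y) / lam <= (z + lam - x) / lam.
  by rewrite ler_pM2r ?invr_gt0//; lra.
rewrite /ramp le_min !ge_min lexx /=; apply/orP; right.
by rewrite ge_max !le_max lexx H orbT.
Qed.

Lemma ramp1 x : x <= z -> ramp x = 1.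
Proof.
move=> xz; apply/min_idPl; rewrite le_max ler_pdivlMr//; apply/orP; right; lra.
Qed.

Lemma ramp0 x : z + lam <= x -> ramp x = 0.
Proof.
move=> xz; rewrite /ramp; have -> : Num.max 0 ((z + lam - x) / lam) = 0.
  by apply/max_idPl; rewrite pmulr_lle0 ?invr_gt0//; lra.
by apply/min_idPr.
Qed.

Lemma ramp_lip x y : `|ramp y - ramp x| <= `|y - x| / lam.
Proof.
wlog xy : x y / x <= y.
  move=> H; have [xy|/ltW yx] := leP x y; first exact: H.
  by rewrite distrC (distrC y); exact: H.
rewrite distrC !ger0_norm ?subr_ge0 ?ramp_le//.
rewrite ler_pdivlMr// /ramp.
have E u : (z + lam - u) / lam * lam = z + lam - u by rewrite divfK// gt_eqF.
have [? ?] := (E x, E y).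
rewrite /Num.min /Num.max; do 4 case: ifP; move=> *; nra.
Qed.

Lemma continuous_ramp : continuous ramp.
Proof.
have c1 : continuous (fun x : R => (z + lam - x) / lam).
  move=> x; apply: cvgM; last exact: cvg_cst.
  by apply: (@cvgB _ R^o); [exact: cvg_cst|exact: cvg_id].
move=> x; rewrite /ramp.
apply: (@continuous_min _ _ (fun=> 1) (fun x => Num.max 0 ((z + lam - x) / lam))).
  exact: cvg_cst.
apply: (@continuous_max _ _ (fun=> 0) (fun x => (z + lam - x) / lam)).
  exact: cvg_cst.
exact: c1.
Qed.

(** Outside the enlarged interval, [x] and [x + t] lie on the same flat side of the ramp; inside,
    the slope is at most [1 / lam]. *)
Lemma ramp_local_lip (delta x t : R) : `|t| <= delta ->
  `|ramp (x + t) - ramp x| <= `|t| * (lam^-1 * \1_`[z - delta, z + lam + delta] x).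
Proof.
move=> td.
have [xI|xI] := boolP (x \in `[z - delta, z + lam + delta]%classic).
  rewrite indicE xI mulr1; apply: (le_trans (ramp_lip x (x + t))).
  by rewrite [x + t]addrC addrK.
rewrite indicE (negbTE xI) !mulr0.
move: xI; rewrite notin_setE/= in_itv/= => /negP; rewrite negb_and -!ltNge.
move: td; rewrite ler_norml => /andP[? ?] /orP[?|?].
  by rewrite !ramp1 ?subrr ?normr0//; lra.
by rewrite !ramp0 ?subrr ?normr0//; lra.
Qed.

End ramp.

(** * A self-bounding inequality for the Kolmogorov distance *)

Section kolmogorov.
Context d (T : measurableType d) (R : realType) (P : probability T R).
Context (V : finType) (A : V -> {RV P >-> R}) (G : simple_graph V).
Local Notation mean := (Rexpectation P).
Variables (X : V -> T -> R) (beta q m : R) (D : nat).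
Hypothesis dG : dependency_graph A G.
Hypothesis Xdep : forall (W : {set V}) v, v \in W -> depends_on A W (X v).
Hypothesis Xmeas : forall v, measurable_fun setT (X v).
Hypothesis Xbeta : forall v w, `|X v w| <= beta.
Hypothesis Xmean : forall v, mean (X v) = 0.
Hypothesis Xq : \sum_v mean (fun w => X v w ^+ 2) <= q.
Hypothesis Xm : \sum_v mean (fun w => `|X v w|) <= m.
Hypothesis ND : forall v, (#|closed_nbhd G v| <= D)%N.
Let W w := \sum_v X v w.
Hypothesis varW : mean (fun w => W w ^+ 2) = 1.
Variables (lam theta kappa : R).
Hypothesis lam0 : 0 < lam.
Let delta := D%:R * beta.
Hypothesis delta0 : 0 < delta.
Hypothesis theta0 : 0 < theta.
Hypothesis thetaE : 4 * D%:R ^+ 3 * beta ^+ 2 * q <= theta ^+ 2.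

Let bX v : bounded_mfun (X v). Proof. by split; [exact: Xmeas|exists beta]. Qed.
Let bW : bounded_mfun W. Proof. exact: bounded_mfun_sum. Qed.
Let cdfW a := fine (P (W @^-1` `]-oo, a])).
Hypothesis kappaE : forall a, `|cdfW a - normal_cdf a| <= kappa.

Let mpre (B : set R) : measurable B -> measurable (W @^-1` B).
Proof. by move=> mB; have [mW _] := bW; have := mW measurableT _ mB; rewrite setTI. Qed.

(** The window has small probability under the Gaussian law, and replacing the law of [W] by it
    costs at most [kappa] at each end. *)
Lemma window_prob_le z :
  window_prob P X beta D z lam <= (lam + 7 * delta) / 2 + 2 * kappa.
Proof.
(* The left end moves by one extra [delta], to [z - 4 delta]: subtracting the closed half-line at
   [z - 3 delta] would also remove the endpoint of the window. Hence the length [lam + 7 delta]. *)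
have H : window_prob P X beta D z lam <= cdfW (z + lam + 3 * delta) - cdfW (z - 4 * delta).
  set I1 := W @^-1` `[z - 3 * delta, z + lam + 3 * delta].
  set I2 := W @^-1` `]-oo, z - 4 * delta].
  set I3 := W @^-1` `]-oo, z + lam + 3 * delta].
  have m1 : measurable I1 by exact: mpre.
  have m2 : measurable I2 by exact: mpre.
  have m3 : measurable I3 by exact: mpre.
  have m12 : measurable (I1 `|` I2) by exact: measurableU.
  have I12 : I1 `&` I2 = set0.
    apply/seteqP; split => // w []; rewrite /I1 /I2 /= !in_itv/= => /andP[? _] ?.
    by exfalso; have := delta0; lra.
  have I123 : I1 `|` I2 `<=` I3.
    move=> w []; rewrite /I1 /I2 /I3 /= !in_itv/=; first by case/andP.
    by move=> Ww; have := delta0; have := lam0; lra.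
  rewrite lerBrDr /window_prob /cdfW -/delta -/W -/I1 -/I2 -/I3 -fineD ?fin_num_measure//.
  rewrite -measureU// fine_le ?fin_num_measure// le_measure ?inE//.
apply: (le_trans H).
have zz : z - 4 * delta <= z + lam + 3 * delta.
  by have := delta0; have := lam0; lra.
have /andP[_] := normal_cdfB zz.
have := kappaE (z + lam + 3 * delta); have := kappaE (z - 4 * delta).
rewrite !ler_norml => /andP[? ?] /andP[? ?]; lra.
Qed.

Let err := theta + delta ^+ 2 / 2 * m *
  (3 + 2 * delta + lam^-1 * ((lam + 7 * delta) / 2 + 2 * kappa)).

Lemma ramp_mean_le z :
  `|mean (fun w => ramp z lam (W w)) - normal_mean (ramp z lam)| <= err.
Proof.
have hc := @continuous_ramp R z lam.
have h01 := @ramp01 R z lam.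
have hd := @ramp_le R z lam lam0.
set h := ramp z lam in hc h01 hd *; set c := normal_mean h.
pose f := stein_sol h; pose f' x := x * f x + (h x - c).
have fc : continuous f by exact: continuous_stein_sol.
have f0 x : 0 <= f x by exact: stein_sol_ge0.
have f2 x : `|f x| <= 2 by rewrite ger0_norm// stein_sol_le2.
have f'c : continuous f'.
  move=> x; apply: (@cvgD _ R^o); first by apply: cvgM; [exact: cvg_id|exact: fc].
  by apply: (@cvgB _ R^o); [exact: hc|exact: cvg_cst].
have f'1 x : `|f' x| <= 1 by exact: stein_sol_derive_le.
have fm : measurable_fun setT f by exact: continuous_measurable_fun.
have f'm : measurable_fun setT f' by exact: continuous_measurable_fun.
have hm : measurable_fun setT h by exact: continuous_measurable_fun.
have lipf' x t : `|t| <= delta -> `|f' (x + t) - f' x| <=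
   `|t| * (2 + `|x| + lam^-1 * \1_`[z - 1 * delta, z + lam + 1 * delta] x).
  rewrite mul1r => td.
  (* The three terms are bounded through [f <= 2], the 1-Lipschitz property of [f], and
     [ramp_local_lip]. *)
  have -> : f' (x + t) - f' x = t * f (x + t) + (x * (f (x + t) - f x) + (h (x + t) - h x)).
    by rewrite /f'; ring.
  rewrite [leRHS]mulrDr [X in _ <= X + _]mulrDr -[leRHS]addrA.
  apply: (le_trans (ler_normD _ _)); apply: lerD.
    rewrite normrM; apply: ler_wpM2l; [exact: normr_ge0|exact: f2].
  apply: (le_trans (ler_normD _ _)); apply: lerD; last exact: ramp_local_lip.
  rewrite normrM mulrC ler_wpM2r//.
  by have := stein_sol_lip hc h01 hd x (x + t); rewrite [x + t]addrC addrK.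
have := @stein_local_dependence _ _ _ _ _ _ _ X beta q m D dG Xdep Xmeas Xbeta Xmean Xq Xm ND varW
  f f' z lam theta lam0 (ltW delta0) (is_derive_stein_sol hc h01) fm f'm f2 f'1 lipf' theta0 thetaE.
have bhW : bounded_mfun (fun w => h (W w)).
  apply: (@bounded_mfun_comp _ _ _ h 1) => // x.
  by have /andP[? ?] := h01 x; rewrite ger0_norm.
have bfW : bounded_mfun (fun w => W w * f (W w)).
  apply: bounded_mfunM => //; exact: (@bounded_mfun_comp _ _ _ f 2).
have bc (r : R) : bounded_mfun (fun _ : T => r) := bounded_mfun_cst T r.
have bhc : bounded_mfun (fun w => h (W w) - c) by exact: bounded_mfunB.
rewrite -/W /f' meanD// meanB// mean_cst addrC addKr => /le_trans; apply.
rewrite /err -/delta lerD2l ler_wpM2l//.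
  rewrite mulr_ge0 ?divr_ge0 ?sqr_ge0//; apply: le_trans Xm.
  by apply: sumr_ge0 => v _; exact: mean_ge0.
by rewrite lerD2l ler_wpM2l ?invr_ge0 ?(ltW lam0)// window_prob_le.
Qed.

Let normal_ramp z : normal_cdf z <= normal_mean (ramp z lam) <= normal_cdf (z + lam).
Proof.
have hc := @continuous_ramp R z lam.
have h01 := @ramp01 R z lam.
have hd := @ramp_le R z lam lam0.
have := normal_mean_bounds hc h01 hd z.
have /andP[_] := normal_mean_bounds hc h01 hd (z + lam).
have r1 : ramp z lam z = 1 by exact: ramp1.
have r0 : ramp z lam (z + lam) = 0 by exact: ramp0.
by rewrite r1 r0 mul1r mul0r addr0 => -> /andP[-> _].
Qed.

(** The indicator of []-oo, a]] lies between the ramps starting at [a - lam] and at [a]; the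
    Gaussian means of these differ from [normal_cdf a] by at most [lam / 2]. *)
Lemma kolmogorov_self_bound a : `|cdfW a - normal_cdf a| <= lam / 2 + err.
Proof.
have bh z : bounded_mfun (fun w => ramp z lam (W w)).
  apply: (@bounded_mfun_comp _ _ _ (ramp z lam) 1) => //.
    by apply: continuous_measurable_fun; exact: continuous_ramp.
  by move=> x; have /andP[? ?] := @ramp01 R z lam x; rewrite ger0_norm.
have mA : measurable (W @^-1` `]-oo, a]) by exact: mpre.
have bi : bounded_mfun (\1_(W @^-1` `]-oo, a]) : T -> R) by exact: bounded_mfun_indic.
have E : cdfW a = mean (\1_(W @^-1` `]-oo, a])) by rewrite mean_indic.
have U : cdfW a <= mean (fun w => ramp a lam (W w)).
  rewrite E; apply: le_mean => // w; rewrite indicE.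
  case: (boolP (w \in _)) => [|_]; last by case/andP: (@ramp01 R a lam (W w)).
  by rewrite inE /= in_itv/= => Wa; rewrite ramp1.
have L : mean (fun w => ramp (a - lam) lam (W w)) <= cdfW a.
  rewrite E; apply: le_mean => // w; rewrite indicE.
  case: (boolP (w \in _)) => [_|]; first by case/andP: (@ramp01 R (a - lam) lam (W w)).
  rewrite notin_setE /= in_itv/= => /negP; rewrite -ltNge => aW.
  by rewrite ramp0//; lra.
have := ramp_mean_le a; have := ramp_mean_le (a - lam).
have /andP[? ?] := normal_ramp a; have /andP[] := normal_ramp (a - lam).
rewrite subrK => ? ?.
have a1 : a <= a + lam by rewrite lerDl ltW.
have a2 : a - lam <= a by rewrite gerBl ltW.
have /andP[_ ?] := normal_cdfB a1.
have /andP[_ ?] := normal_cdfB a2.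
rewrite !ler_norml => /andP[? ?] /andP[? ?]; apply/andP; split; lra.
Qed.
End kolmogorov.

(** * Invariance under almost sure equality *)

Section ae.
Context d (T : measurableType d) (R : realType) (P : probability T R).

Lemma sum_RVE (V : finType) (A : V -> {RV P >-> R}) w :
  (\sum_v A v : {RV P >-> R}) w = \sum_v A v w.
Proof. by elim: (index_enum V) => [|i r IH]; rewrite ?big_nil ?big_cons//= -IH. Qed.

Lemma ae_eq_mean (X Y : T -> R) : measurable_fun setT X -> measurable_fun setT Y ->
  {ae P, forall w, X w = Y w} -> (\int[P]_w (X w)%:E = \int[P]_w (Y w)%:E)%E.
Proof.
move=> mX mY XY; apply: ae_eq_integral => //; try exact/measurable_EFinP.
by apply: filterS XY => w + _ => ->.
Qed.

Lemma ae_eq_measure (X Y : T -> R) (B : set R) : measurable_fun setT X -> measurable_fun setT Y ->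
  {ae P, forall w, X w = Y w} -> measurable B -> P (X @^-1` B) = P (Y @^-1` B).
Proof.
move=> mX mY XY mB.
have m1 : measurable (X @^-1` B) by have := mX measurableT _ mB; rewrite setTI.
have m2 : measurable (Y @^-1` B) by have := mY measurableT _ mB; rewrite setTI.
have E (C : set T) : measurable C -> P C = (\int[P]_w (\1_C w : R)%:E)%E.
  by move=> mC; rewrite integral_indic// setIT.
rewrite E// [RHS]E//; apply: ae_eq_mean; [exact: measurable_indic|exact: measurable_indic|].
apply: filterS XY => w XYw; rewrite !indicE; congr (_%:R); congr nat_of_bool.
by apply/idP/idP; rewrite !inE /= XYw.
Qed.
End ae.

(** * The Kolmogorov distance as a supremum *)

Section dKol.
Variable R : realType.
Variables (mu nu : set R -> \bar R).
Hypothesis mu01 : forall a, 0 <= fine (mu `]-oo, a]) <= 1.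
Hypothesis nu01 : forall a, 0 <= fine (nu `]-oo, a]) <= 1.

Lemma dist_cdf_le1 a : `|fine (mu `]-oo, a]) - fine (nu `]-oo, a])| <= 1.
Proof.
have /andP[? ?] := mu01 a; have /andP[? ?] := nu01 a.
by rewrite ler_norml; apply/andP; split; lra.
Qed.

(** The set of differences is bounded above by 1, which makes [sup] a genuine upper bound. *)
Lemma le_dKol a : `|fine (mu `]-oo, a]) - fine (nu `]-oo, a])| <= dKol mu nu.
Proof.
apply: ub_le_sup; last by exists a.
by exists 1 => _ [b _ <-]; exact: dist_cdf_le1.
Qed.

Lemma dKol_le k : (forall a, `|fine (mu `]-oo, a]) - fine (nu `]-oo, a])| <= k) -> dKol mu nu <= k.
Proof.
move=> H; apply: ge_sup; first by exists `|fine (mu `]-oo, 0]) - fine (nu `]-oo, 0])|; exists 0.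
by move=> _ [b _ <-]; exact: H.
Qed.
End dKol.

(** * The bound for a single sum *)

Section single.
Context d (T : measurableType d) (R : realType) (P : probability T R).
Context (V : finType) (A_ : V -> {RV P >-> R}) (S : {RV P >-> R}) (G : simple_graph V).
Variables (D : nat) (A N : R).
Hypothesis A0 : 0 < A.
Hypothesis SE : S = \sum_v A_ v.
Hypothesis A_le : forall v, {ae P, forall w, `|A_ v w| <= A}.
Hypothesis V0 : (0 < 'V_P[S])%E.
Hypothesis dG : dependency_graph A_ G.
Hypothesis DE : D = (max_degree G).+1.
Hypothesis NE : N = (\sum_v fine 'E_P[fun w => `|A_ v w|%R]) / A.

Local Notation mean := (Rexpectation P).

(* The bound on [A_ v] holds only almost surely; clamping makes it sure, and
   the clamped variable is still a function of [A_ v], so that the dependency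
   graph applies to it. *)
Let clamp (x : R) := Num.max (- A) (Num.min A x).
Let clamp_meas : measurable_fun setT clamp.
Proof. by apply: measurable_maxr => //; exact: measurable_minr. Qed.
Let clamp_le x : `|clamp x| <= A.
Proof. rewrite /clamp ler_norml le_max lexx/= ge_max ge_min lexx/= andbT.
by rewrite -subr_ge0 opprK addr_ge0// ltW.
Qed.
Let clamp_id x : `|x| <= A -> clamp x = x.
Proof.
rewrite ler_norml /clamp => /andP[? ?]; have -> : Num.min A x = x by exact/min_idPr.
exact/max_idPr.
Qed.

Let B v w := clamp (A_ v w).
Let B_le v w : `|B v w| <= A. Proof. exact: clamp_le. Qed.
Let mB v : measurable_fun setT (B v).
Proof. exact: measurableT_comp. Qed.
Let bB v : bounded_mfun (B v). Proof. by split; [exact: mB|exists A => w; exact: B_le]. Qed.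
Let SB w := \sum_v B v w.
Let bSB : bounded_mfun SB. Proof. exact: bounded_mfun_sum. Qed.

Let AB : {ae P, forall w, forall v, A_ v w = B v w}.
Proof.
apply: filter_forall => v; apply: filterS (A_le v) => w Aw.
by rewrite /B clamp_id.
Qed.

Let SSB : {ae P, forall w, S w = SB w}.
Proof.
apply: filterS AB => w H; rewrite SE sum_RVE; apply: eq_bigr => v _; exact: H.
Qed.

Let e v := mean (B v).
Let mu := fine 'E_P[S].
Let muE : mu = \sum_v e v.
Proof.
rewrite /mu expectation_def (ae_eq_mean _ _ SSB)//; last by case: bSB.
exact: (mean_sum P).
Qed.

Let sq := mean (fun w => (SB w - mu) ^+ 2).

Let varE : 'V_P[S] = sq%:E.
Proof.
have expE (U : T -> R) : ('E_P[U] = \int[P]_w (U w)%:E)%E by rewrite unlock.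
rewrite /variance covariance.unlock -/mu expE.
have bd : bounded_mfun (fun w => (SB w - mu) ^+ 2).
  by apply: bounded_mfunX; apply: bounded_mfunB => //; exact: bounded_mfun_cst.
transitivity (\int[P]_w ((SB w - mu) ^+ 2)%:E)%E.
  apply: ae_eq_mean.
  - by apply: measurable_funM; apply: measurable_funB.
  - by case: bd.
  - by apply: filterS SSB => w /= Sw; rewrite -Sw expr2.
rewrite /sq /Rexpectation /Rintegral fineK//; apply: integrable_fin_num => //.
exact: bounded_mfun_integrable.
Qed.

Let NE' : N = (\sum_v mean (fun w => `|B v w|)) / A.
Proof.
rewrite NE; congr (_ / _); apply: eq_bigr => v _.
rewrite unlock; congr fine; apply: ae_eq_mean.
- exact: measurableT_comp.
- exact: measurableT_comp.
- by apply: filterS AB => w ->.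
Qed.

Let sq0 : 0 < sq. Proof. by rewrite -lte_fin -varE. Qed.
Let s := Num.sqrt sq.
Let s0 : 0 < s. Proof. by rewrite sqrtr_gt0. Qed.
Let s2 : s ^+ 2 = sq. Proof. by rewrite sqr_sqrtr// ltW. Qed.

(** Each summand is centred by its own mean, so that the [X v] sum to the standardized clamped sum,
    almost surely equal to [standardize S]. *)
Let X v w := s^-1 * (B v w - e v).
Let W w := \sum_v X v w.
Let WE w : W w = s^-1 * (SB w - mu).
Proof. by rewrite /W -mulr_sumr sumrB -muE. Qed.

Let bBe v : bounded_mfun (fun w => B v w - e v).
Proof. by apply: bounded_mfunB => //; exact: bounded_mfun_cst. Qed.
Let bX v : bounded_mfun (X v).
Proof. by apply: bounded_mfunM => //; exact: bounded_mfun_cst. Qed.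
Let bW : bounded_mfun W. Proof. exact: bounded_mfun_sum. Qed.

Let cdfE a : fine (distribution P (standardize S) `]-oo, a]) = fine (P (W @^-1` `]-oo, a])).
Proof.
congr fine; apply: (@ae_eq_measure _ _ _ P (standardize S) W `]-oo, a]) => //.
- by case: bW.
- apply: filterS SSB => w; rewrite /standardize => ->.
  by rewrite WE varE mulrC.
Qed.

Let Xdep (U : {set V}) v : v \in U -> depends_on A_ U (X v).
Proof.
move=> vU; apply: depends_onM; first exact: depends_on_cst.
apply: depends_onD; last exact: depends_on_cst.
by apply: depends_on_comp => //; exact: depends_on_coord.
Qed.

Let e_le v : `|e v| <= mean (fun w => `|B v w|). Proof. exact: normr_mean_le. Qed.
Let bBn v : bounded_mfun (fun w => `|B v w|). Proof. exact: bounded_mfun_norm. Qed.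
Let absB_le v : mean (fun w => `|B v w|) <= A.
Proof. by rewrite -[leRHS](mean_cst P); apply: le_mean => //; exact: bounded_mfun_cst. Qed.

(** The factor 2 is the price of centring; it reappears in [m]. *)
Let beta := 2 * A / s.
Let Xbeta v w : `|X v w| <= beta.
Proof.
rewrite /X /beta normrM (gtr0_norm (_ : 0 < s^-1)) ?invr_gt0// mulrC ler_pM2r ?invr_gt0//.
apply: (le_trans (ler_normB _ _)).
have := B_le v w; have := le_trans (e_le v) (absB_le v); lra.
Qed.

Let Xmean v : mean (X v) = 0.
Proof. by rewrite meanZ// meanB ?mean_cst ?subrr ?mulr0//; exact: bounded_mfun_cst. Qed.

Let q := N * A ^+ 2 / s ^+ 2.
(** Centring does not increase second moments, and [B^2 <= A |B|], where the means of the [|B v|]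
    add up to [N A]. *)
Let Xq : \sum_v mean (fun w => X v w ^+ 2) <= q.
Proof.
apply: (@le_trans _ _ (\sum_v s^-1 ^+ 2 * (A * mean (fun w => `|B v w|)))).
  apply: ler_sum => v _.
  have bB2 : bounded_mfun (fun w => B v w ^+ 2) by exact: bounded_mfunX.
  have bc (r : R) : bounded_mfun (fun _ : T => r) := bounded_mfun_cst T r.
  have b1 : bounded_mfun (fun w => 2 * e v * B v w) by exact: bounded_mfunM.
  have b2 : bounded_mfun (fun w => 2 * e v * B v w - e v ^+ 2) by exact: bounded_mfunB.
  have b3 : bounded_mfun (fun w => B v w ^+ 2 - (2 * e v * B v w - e v ^+ 2)).
    exact: bounded_mfunB.
  have -> : (fun w => X v w ^+ 2) =
      (fun w => s^-1 ^+ 2 * (B v w ^+ 2 - (2 * e v * B v w - e v ^+ 2))).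
    by apply/funext => w; rewrite /X; ring.
  rewrite meanZ// ler_wpM2l ?sqr_ge0// !meanB// meanZ// mean_cst -/(e v) -meanZ//.
  have H : mean (fun w => B v w ^+ 2) <= mean (fun w => A * `|B v w|).
    apply: le_mean => //; first exact: bounded_mfunM.
    by move=> w; rewrite -real_normK ?num_real// expr2 ler_wpM2r.
  have := sqr_ge0 (e v); lra.
rewrite -mulr_sumr -mulr_sumr /q NE' exprVn le_eqVlt; apply/orP; left; apply/eqP; field.
by rewrite !gt_eqF.
Qed.

Let m := 2 * N * A / s.
Let Xm : \sum_v mean (fun w => `|X v w|) <= m.
Proof.
apply: (@le_trans _ _ (\sum_v s^-1 * (2 * mean (fun w => `|B v w|)))).
  apply: ler_sum => v _.
  have bc (r : R) : bounded_mfun (fun _ : T => r) := bounded_mfun_cst T r.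
  have b1 : bounded_mfun (fun w => `|B v w| + `|e v|) by exact: bounded_mfunD.
  apply: (@le_trans _ _ (mean (fun w => s^-1 * (`|B v w| + `|e v|)))).
    apply: le_mean; [exact: bounded_mfun_norm|exact: bounded_mfunM|].
    move=> w; rewrite /X normrM (gtr0_norm (_ : 0 < s^-1)) ?invr_gt0// ler_pM2l ?invr_gt0//.
    exact: ler_normB.
  rewrite meanZ// ler_pM2l ?invr_gt0// meanD// mean_cst.
  have := e_le v; lra.
rewrite -mulr_sumr -mulr_sumr /m NE' le_eqVlt; apply/orP; left; apply/eqP; field.
by rewrite !gt_eqF.
Qed.

Let ND v : (#|closed_nbhd G v| <= D)%N.
Proof.
rewrite DE; apply: (@leq_trans (degree G v).+1); last by rewrite ltnS; exact: leq_bigmax.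
have -> : closed_nbhd G v = v |: [set u | G v u]%SET.
  by apply/setP => u; rewrite !inE.
rewrite cardsU1 -add1n leq_add ?leq_b1//.
by rewrite /degree cardsE.
Qed.

Let varW : mean (fun w => W w ^+ 2) = 1.
Proof.
have bd : bounded_mfun (fun w => (SB w - mu) ^+ 2).
  by apply: bounded_mfunX; apply: bounded_mfunB => //; exact: bounded_mfun_cst.
have -> : (fun w => W w ^+ 2) = (fun w => s^-1 ^+ 2 * (SB w - mu) ^+ 2).
  by apply/funext => w; rewrite WE exprMn.
by rewrite meanZ// -/sq -s2 exprVn mulVf// expf_neq0// gt_eqF.
Qed.

Let D0 : 0 < D%:R :> R. Proof. by rewrite DE ltr0n. Qed.

Let eps := N * D%:R ^+ 2 * A ^+ 3 / s ^+ 3.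

(** The self-bound is applied with [kappa] equal to the distance [k] itself and solved for [k]. *)
Lemma dKol_dependency_graph_le :
  dKol (distribution P (standardize S)) (normal_prob 0 1) <=
  (52 + 52 / 100) * (N * D%:R ^+ 2 * A ^+ 3 / Num.sqrt (fine 'V_P[S]) ^+ 3).
Proof.
rewrite varE [fine _]/= -/s -/eps.
have y1 : 1 <= D%:R * q := le_var_deg dG Xdep (fun v => (bX v).1) Xbeta Xmean Xq ND varW.
(* Everything is expressed through [x] and [y]: [eps = x y], and [y >= 1] gives [x <= eps]. *)
set x := D%:R * A / s; set y := D%:R * q in y1.
have x0 : 0 < x by rewrite divr_gt0// mulr_gt0.
have epsE : eps = x * y by rewrite /eps /x /y /q; field; rewrite gt_eqF.
have eps0 : 0 < eps by rewrite epsE mulr_gt0//; lra.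
have xe : x <= eps by rewrite epsE; nra.
have deltaE : D%:R * beta = 2 * x by rewrite /beta /x; field; rewrite gt_eqF.
set k := dKol _ _.
have mu01 a : 0 <= fine (distribution P (standardize S) `]-oo, a]) <= 1.
  rewrite fine_ge0//= -lee_fin fineK ?fin_num_measure//.
  exact: probability_le1.
have nu01 a : 0 <= fine (normal_prob (0:R) 1 `]-oo, a]) <= 1.
  by rewrite normal_cdf_ge0 normal_cdf_le1.
(* A Kolmogorov distance is at most 1, so only [eps < 1 / 52.52] needs an argument. *)
have [big|small] := leP 1 ((52 + 52 / 100) * eps).
  by apply: le_trans big; apply: dKol_le; exact: dist_cdf_le1.
have kE a : `|fine (P (W @^-1` `]-oo, a])) - normal_cdf a| <= k.
  by rewrite -cdfE; exact: (@le_dKol _ _ _ mu01 nu01).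
(* In the self-bound [k] has coefficient [4 eps * 2 / lam]; the choice [lam = 32 eps] makes it
   [1/4]. *)
have lam0 : 0 < 32 * eps by rewrite mulr_gt0.
have theta0 : 0 < 4 * eps by rewrite mulr_gt0.
have delta0 : 0 < D%:R * beta by rewrite deltaE mulr_gt0.
(* The left side is [16 x^2 y], at most [(4 x y)^2] because [y >= 1]. *)
have thetaE : 4 * D%:R ^+ 3 * beta ^+ 2 * q <= (4 * eps) ^+ 2.
  have -> : 4 * D%:R ^+ 3 * beta ^+ 2 * q = 4 * (D%:R * beta) ^+ 2 * y by rewrite /y; ring.
  rewrite deltaE epsE.
  have -> : 4 * (2 * x) ^+ 2 * y = 16 * x ^+ 2 * y by ring.
  have -> : (4 * (x * y)) ^+ 2 = 16 * x ^+ 2 * (y * y) by ring.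
  have c0 : 0 <= 16 * x ^+ 2 by rewrite mulr_ge0 ?sqr_ge0.
  apply: (ler_wpM2l c0); apply: ler_peMr => //; lra.
have H a := kolmogorov_self_bound dG Xdep (fun v => (bX v).1) Xbeta Xmean Xq Xm ND varW
   lam0 delta0 theta0 thetaE kE a.
(* The 34 collects 16 from [lam / 2], 4 from [theta], and [4 * (3 + 1/2)] from the remainder. *)
have {}H : k <= 34 * eps + 16 * eps * x + 7 / 8 * x + k / 4.
  apply: dKol_le => a; rewrite cdfE; apply: (le_trans (H a)).
  rewrite deltaE.
  have -> : (2 * x) ^+ 2 / 2 * m = 4 * eps.
    by rewrite /m /eps /x; field; rewrite gt_eqF.
  rewrite le_eqVlt; apply/orP; left; apply/eqP; field; lra.
(* With [x <= eps < 1 / 52.52], the terms without [k] are below [35.2 eps], so that [k < 47 eps]. *)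
nra.
Qed.
End single.

Theorem mainTheorem10 (R : realType)
  (d : nat -> measure_display) (Omega : forall n, measurableType (d n))
  (P : forall n, probability (Omega n) R)
  (V : nat -> finType) (A_ : forall n, V n -> {RV (P n) >-> R})
  (S_ : forall n, {RV (P n) >-> R})
  (G : forall n, simple_graph (V n)) (D : nat -> nat)
  (A : R) (N sigma : nat -> R) :
  0 < A ->
  (forall n, S_ n = \sum_(v : V n) A_ n v) ->
  (forall n (v : V n), {ae P n, forall w, `|A_ n v w| <= A}) ->
  (forall n, (0 < 'V_(P n)[S_ n])%E) ->
  (forall n, dependency_graph (A_ n) (G n)) ->
  (forall n, D n = (max_degree (G n)).+1) ->
  (forall n, N n =
    (\sum_(v : V n) fine 'E_(P n)[fun w => `|A_ n v w|%R]) / A) ->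
  (forall n, 0 < sigma n) ->
  (forall n, sigma n ^+ 2 = fine 'V_(P n)[S_ n] / (N n * (D n)%:R)) ->
  forall n,
    dKol (distribution (P n) (standardize (S_ n))) (normal_prob 0 1) <=
    (52 + 52 / 100) * A ^+ 3 / sigma n ^+ 3 * Num.sqrt ((D n)%:R / N n).
Proof.
move=> A0 SE A_le V0 dG DE NE sig0 sigE n.
have := dKol_dependency_graph_le A0 (SE n) (A_le n) (V0 n) (dG n) (DE n) (NE n).
move=> /le_trans; apply.
have := sigE n; have := sig0 n.
set v := fine _; set s := sigma n; set M := N n => s0 s2.
have D0 : 0 < (D n)%:R :> R by rewrite DE ltr0n.
have v0 : 0 <= v by rewrite fine_ge0// variance_ge0.
(* If [N n] were nonpositive, the quotient defining [sigma n ^+ 2] would be nonpositive too, also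
   when it is a division by 0. *)
have M0 : 0 < M.
  rewrite ltNge; apply/negP => M0.
  have : 0 < s ^+ 2 by rewrite exprn_gt0.
  rewrite s2 ltNge => /negP; apply.
  by rewrite mulr_ge0_le0// invr_le0 mulr_le0_ge0// ltW.
have MD0 : 0 < M * (D n)%:R by rewrite mulr_gt0.
(* In terms of [r = sqrt (N D)]: [sqrt (Var S) = sigma r], [sqrt (D / N) = D / r] and [N = r^2 / D],
   after which the two bounds are the same rational expression. *)
set r := Num.sqrt (M * (D n)%:R).
have r0 : 0 < r by rewrite sqrtr_gt0.
have r2 : r ^+ 2 = M * (D n)%:R by rewrite sqr_sqrtr// ltW.
have -> : Num.sqrt v = s * r.
  have -> : v = (s * r) ^+ 2 by rewrite exprMn r2 s2 divfK// gt_eqF.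
  by rewrite sqrtr_sqr ger0_norm// mulr_ge0 ?ltW.
have -> : Num.sqrt ((D n)%:R / M) = (D n)%:R / r.
  have -> : (D n)%:R / M = ((D n)%:R / r) ^+ 2.
    by rewrite exprMn exprVn r2; field; rewrite !gt_eqF.
  by rewrite sqrtr_sqr ger0_norm// divr_ge0// ltW.
have -> : M = r ^+ 2 / (D n)%:R by rewrite r2 mulfK// gt_eqF.
rewrite le_eqVlt; apply/orP; left; apply/eqP; field.
by rewrite !gt_eqF.
Qed.
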